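(* Let $n>2$ and let $L$ be the $(n-2)$-skeleton (codimension 3 skeleton) of the $(n+1)$-simplex. The space $C(L)$ of unlabeled codimension 3 skeleta of the $(n+1)$-simplex linearly embedded in $\mathbb R^n$ deformation retracts to the pyramidal space $P(L)$.
   Context: A linear embedding of $L$ in $\mathbb R^n$ is an injective map $L\to\mathbb R^n$ that is affine on each simplex; it is determined by the images of the $n+2$ vertices, so the space $E(L)$ of linear embeddings is a subspace of $(\mathbb R^n)^{n+2}$. $C(L)=E(L)/S_{n+2}$ is the quotient by relabeling of vertices. The pyramidal space $P(L)\subset C(L)$ consists of the configurations for which there is a regular $(n-1)$-simplex $F$ of unit edge length, spanned by $n$ of the vertices, such that: one of the two remaining vertices together with $F$ spans a regular $n$-simplex $\Delta$; the other remaining vertex $a$ lies on the line perpendicular to $F$ through the barycenter of $F$, at distance from that barycenter between $0$ and the height of a regular $n$-simplex with unit edges, both values included; if $a$ is contained in $\Delta$, then $a$ lies on the closed segment between the barycenter of $\Delta$ and the barycenter of $F$ (otherwise $a$ lies on the opposite side of $F$ from $\Delta$); and the barycenter of the configuration (the average of the $n+2$ vertices) is at the origin. *)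

(* Defs.v *)
From HB Require Import structures.
From mathcomp Require Import all_boot all_order all_algebra fingroup perm generic_quotient.
From mathcomp Require Import all_classical all_reals all_analysis.

Set Implicit Arguments.
Unset Strict Implicit.
Unset Printing Implicit Defensive.

Import Order.TTheory GRing.Theory Num.Theory.
Import numFieldNormedType.Exports.

Local Open Scope classical_set_scope.
Local Open Scope ring_scope.

Section Euclidean.
Context {R : realType} {n : nat}.
Implicit Types u v : 'rV[R]_n.

Definition dot u v : R := \sum_k u 0 k * v 0 k.

(* The norm `|u| that the library puts on 'rV[R]_n is the sup norm, so the
   Euclidean distance is defined by hand; both induce the same topology. *)
Definition eucl_dist u v : R := Num.sqrt (dot (u - v) (u - v)).

Definition segment u v : set 'rV[R]_n :=
  [set (1 - t) *: u + t *: v | t in `[0, 1]].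

End Euclidean.

(* An abstract simplicial complex on the vertices 0, ..., m-1 is the set K of
   its nonempty faces. A point of its geometric realization is the row vector
   of its barycentric coordinates. *)
Section Complexes.
Context (R : realType).

Definition closed_simplex m (s : {set 'I_m}) : set 'rV[R]_m :=
  [set w | [/\ forall i, 0 <= w 0 i,
               forall i, i \notin s -> w 0 i = 0
             & \sum_i w 0 i = 1]].

Definition realization m (K : {set {set 'I_m}}) : set 'rV[R]_m :=
  \bigcup_(s in [set` K]) closed_simplex s.

(* The d-skeleton of the m-simplex, whose vertices are 0, ..., m. *)
Definition skeleton (d m : nat) : {set {set 'I_m.+1}} :=
  [set s : {set 'I_m.+1} | (0 < #|s| <= d.+1)%N]%SET.

(* Only the values of f on the realization of K matter. *)
Definition linear_embedding m n (K : {set {set 'I_m}})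
    (f : 'rV[R]_m -> 'rV[R]_n) : Prop :=
  {in realization K &, injective f} /\
  (forall s, s \in K ->
     forall w w', closed_simplex s w -> closed_simplex s w' ->
     forall t : R, 0 <= t <= 1 ->
       f ((1 - t) *: w + t *: w') = (1 - t) *: f w + t *: f w').

(* The space of linear embeddings of K: row i of x is the image of the vertex i. *)
Definition linear_embeddings m n (K : {set {set 'I_m}}) : set 'M[R]_(m, n) :=
  [set x | exists2 f : 'rV[R]_m -> 'rV[R]_n,
     linear_embedding K f & forall i, f (delta_mx 0 i) = row i x].

End Complexes.

Section Configurations.
Context (R : realType) (n : nat).

Definition embedding_space : set 'M[R]_(n.+2, n) :=
  linear_embeddings (skeleton (n - 2) n.+1).

Definition relabel (x y : embedding_space) : bool :=
  [exists s : 'S_n.+2, row_perm s (val x) == val y].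

Lemma relabel_equiv : equiv_class_of relabel.
Proof.
split=> [x|x y|y x z].
- by apply/existsP; exists 1%g; rewrite row_perm1.
- apply/existsP/existsP => -[s /eqP sE]; exists (s^-1)%g;
    by rewrite -sE -row_permM mulVg row_perm1.
- move=> /existsP[s /eqP sE] /existsP[t /eqP tE].
  by apply/existsP; exists (t * s)%g; rewrite row_permM sE tE.
Qed.

Canonical relabel_equivRel := EquivRelPack relabel_equiv.

(* embedding_space carries the topology of a subset of 'M[R]_(n.+2, n). *)
Definition config_space : topologicalType :=
  quotient_topology {eq_quot relabel_equivRel}%qT.

Definition class_of (x : embedding_space) : config_space := \pi_config_space%qT x.

End Configurations.

Arguments embedding_space R n : clear implicits.

(* In this section the rows of x are m labelled points of R^n. *)
Section Pyramidal.
Context {R : realType} {m n : nat} (x : 'M[R]_(m, n)).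
Implicit Types s F : {set 'I_m}.

Definition barycenter s : 'rV[R]_n := #|s|%:R^-1 *: \sum_(k in s) row k x.

Definition span_simplex s : set 'rV[R]_n :=
  [set w *m x | w in closed_simplex s].

(* A simplex with all edges of length 1; affine independence of the vertices
   is a consequence. *)
Definition unit_regular s : Prop :=
  forall k l, k \in s -> l \in s -> k != l -> eucl_dist (row k x) (row l x) = 1.

Definition on_perp_through_barycenter F (p : 'rV[R]_n) : Prop :=
  forall k l, k \in F -> l \in F ->
    dot (p - barycenter F) (row k x - row l x) = 0.

Definition opposite_sides F (p q : 'rV[R]_n) : Prop :=
  exists (u : 'rV[R]_n) (c : R),
    (forall k, k \in F -> dot u (row k x) = c) /\ dot u p < c < dot u q.

(* v and a are the labels of the two vertices outside F. The foot of the
   altitude from v of the regular simplex Delta is the barycenter of F, so the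
   distance between these two points is the height of Delta. *)
Definition pyramidal : Prop :=
  exists v a : 'I_m, v != a /\
    let F := (~: [set v; a])%SET in
    let Delta := (v |: F)%SET in
    let pa := row a x in
    [/\ unit_regular F /\ unit_regular Delta,
        on_perp_through_barycenter F pa,
        0 <= eucl_dist pa (barycenter F) <= eucl_dist (row v x) (barycenter F),
        (span_simplex Delta pa ->
           segment (barycenter Delta) (barycenter F) pa) /\
        (~ span_simplex Delta pa -> opposite_sides F pa (row v x))
      & barycenter [set: 'I_m]%SET = 0].

End Pyramidal.

Definition pyramidal_space (R : realType) (n : nat) : set (config_space R n) :=
  [set class_of x | x in [set x : embedding_space R n | pyramidal (val x)]].

Arguments pyramidal_space R n : clear implicits.

(* The homotopy is required to fix every point of A at all times. *)
Definition deformation_retracts (R : realType) (X : topologicalType)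
    (A : set X) : Prop :=
  exists H : X * R -> X,
    [/\ {within [set: X] `*` `[0, 1], continuous H},
        forall x, H (x, 0) = x,
        forall x, A (H (x, 1))
      & forall a (t : R), A a -> 0 <= t <= 1 -> H (a, t) = a].
Arguments deformation_retracts R X A : clear implicits.

(* Main.v *)
From mathcomp Require Import all_boot all_order all_algebra fingroup perm generic_quotient.
From mathcomp Require Import all_classical all_reals all_analysis.
From mathcomp Require Import ring lra.
Require Import Defs.

Set Implicit Arguments.
Unset Strict Implicit.
Unset Printing Implicit Defensive.

Import Order.TTheory GRing.Theory Num.Theory.
Import numFieldNormedType.Exports.

Local Open Scope classical_set_scope.
Local Open Scope ring_scope.

(** An affine dependency of n + 2 points in R^n is a vector of weights with sum
    zero whose weighted sum of the points vanishes. The points span a linear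
    embedding of the (n - 2)-skeleton exactly when every nonzero dependency has at
    least n weights of the same strict sign ([embedding_spaceP]): otherwise its
    positive and negative parts, rescaled, are points of two faces with the same
    image. Such dependencies form a line ([dependency_line]), since the circle of
    directions in a plane of dependencies would be the disjoint union of two
    antipodal open sets, n positive and n negative weights being impossible
    together. Normalizing the n-th largest weight to 1 selects one dependency
    [lam x], which is unique and therefore invariant under relabelling, and which
    depends continuously on [x] ([cvg_lam]).

    The pyramidal configurations have the dependencies with weights 1 on the base,
    s on the apex and - (n + s) on the last vertex, for - n / 2 <= s <= 1. Cutting
    the positive weights off at 1 and rescaling the negative ones turns every
    normalized dependency into one of these ([cap_weights]) by a continuous and
    symmetric recipe that fixes the pyramidal ones, and the straight path to the
    result keeps all signs.

    For a given dependency l, a centred configuration is a frame, given by its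
    columns, of the n-dimensional space orthogonal to l and to the constants. As
    the dependency moves along the path, the frame is carried along by orthogonal
    projection, which stays injective because the signs are kept. The frames of
    the final space differ by invertible matrices acting on the right, which
    commutes with relabelling. Writing the Gram matrix of the pyramidal
    configuration as y Q y^T, where y is the final frame, the Cholesky factor T of
    Q makes y T pyramidal. The segment from the identity to T consists of
    invertible matrices, and T is the identity if the configuration was pyramidal
    from the start. The Gram matrix must be a continuous and symmetric function of the weights, which is
    the purpose of the formula [shape].

    The resulting flow is equivariant, ends in pyramidal configurations
    ([flow_end]) and fixes them ([flow_pyramid]). It descends to the quotient
    because the quotient map by the finite group of relabellings is open. *)

(** * Convergence of matrices *)

Section MatrixConvergence.
Context {R : realType} {T : Type} {F : set_system T} {FF : Filter F}.

Lemma cvg_mx m n (f : T -> 'M[R]_(m, n)) (M : 'M[R]_(m, n)) :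
  (forall i j, f x i j @[x --> F] --> M i j) -> f @ F --> M.
Proof.
move=> fM A [P MP PA].
suff FPf : F [set x | forall i j, P i j (f x i j)].
  by change (F (f @^-1` A)); apply: filterS FPf => x Px; exact: (PA (f x)).
have FP i j : F [set x | P i j (f x i j)] by apply: fM.
have : forall i, F [set x | forall j, P i j (f x i j)].
  by move=> i; apply: filter_forall => j; apply: FP.
by move=> /filter_forall.
Qed.

Lemma cvg_coord m n (f : T -> 'M[R]_(m, n)) (M : 'M[R]_(m, n)) i j :
  f @ F --> M -> f x i j @[x --> F] --> M i j.
Proof.
move=> fM; apply: (cvg_comp f (fun N : 'M[R]_(m, n) => N i j) fM).
exact: coord_continuous.
Qed.

Lemma cvg_sumr (I : Type) (r : seq I) (P : pred I) (f : I -> T -> R) (l : I -> R) :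
  (forall i, P i -> f i x @[x --> F] --> l i) ->
  \sum_(i <- r | P i) f i x @[x --> F] --> \sum_(i <- r | P i) l i.
Proof. by move=> fl; apply: cvg_big => // -[a b]; exact: add_continuous. Qed.

Lemma cvg_prodr (I : Type) (r : seq I) (P : pred I) (f : I -> T -> R) (l : I -> R) :
  (forall i, P i -> f i x @[x --> F] --> l i) ->
  \prod_(i <- r | P i) f i x @[x --> F] --> \prod_(i <- r | P i) l i.
Proof.
move=> fl; apply: cvg_big => // -[a b].
exact: (cvgM cvg_fst cvg_snd).
Qed.

Lemma cvg_minr (f g : T -> R) (a b : R) : f @ F --> a -> g @ F --> b ->
  Num.min (f x) (g x) @[x --> F] --> Num.min a b.
Proof.
move=> fa gb; under eq_cvg do rewrite minr_absE.
rewrite minr_absE; apply: cvgMr_tmp.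
by apply: cvgB; [exact: cvgD | apply: cvg_norm; exact: cvgB].
Qed.

Lemma cvg_maxr (f g : T -> R) (a b : R) : f @ F --> a -> g @ F --> b ->
  Num.max (f x) (g x) @[x --> F] --> Num.max a b.
Proof.
move=> fa gb; under eq_cvg do rewrite maxr_absE.
rewrite maxr_absE; apply: cvgMr_tmp.
by apply: cvgD; [exact: cvgD | apply: cvg_norm; exact: cvgB].
Qed.

Lemma cvg_mulmx m n p (f : T -> 'M[R]_(m, n)) (g : T -> 'M[R]_(n, p))
    (A : 'M[R]_(m, n)) (B : 'M[R]_(n, p)) :
  f @ F --> A -> g @ F --> B -> f x *m g x @[x --> F] --> A *m B.
Proof.
move=> fA gB; apply: cvg_mx => i j; rewrite mxE.
under eq_cvg do rewrite mxE.
by apply: cvg_sumr => k _; apply: cvgM; exact: cvg_coord.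
Qed.

Lemma cvg_row_mx m n1 n2 (f : T -> 'M[R]_(m, n1)) (g : T -> 'M[R]_(m, n2))
    (A : 'M[R]_(m, n1)) (B : 'M[R]_(m, n2)) :
  f @ F --> A -> g @ F --> B -> row_mx (f x) (g x) @[x --> F] --> row_mx A B.
Proof.
move=> fA gB; apply: cvg_mx => i j; rewrite mxE; under eq_cvg do rewrite mxE.
by case: (fintype.split j) => k; exact: cvg_coord.
Qed.

Lemma cvg_col_mx m1 m2 n (f : T -> 'M[R]_(m1, n)) (g : T -> 'M[R]_(m2, n))
    (A : 'M[R]_(m1, n)) (B : 'M[R]_(m2, n)) :
  f @ F --> A -> g @ F --> B -> col_mx (f x) (g x) @[x --> F] --> col_mx A B.
Proof.
move=> fA gB; apply: cvg_mx => i j; rewrite mxE; under eq_cvg do rewrite mxE.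
by case: (fintype.split i) => k; exact: cvg_coord.
Qed.

Lemma cvg_trmx m n (f : T -> 'M[R]_(m, n)) (A : 'M[R]_(m, n)) :
  f @ F --> A -> (f x)^T @[x --> F] --> A^T.
Proof.
move=> fA; apply: cvg_mx => i j; rewrite mxE.
by under eq_cvg do rewrite mxE; exact: cvg_coord.
Qed.

Lemma cvg_det n (f : T -> 'M[R]_n) (A : 'M[R]_n) :
  f @ F --> A -> \det (f x) @[x --> F] --> \det A.
Proof.
move=> fA; apply: cvg_sumr => s _; apply: cvgM; first exact: cvg_cst.
by apply: cvg_prodr => i _; exact: cvg_coord.
Qed.

Lemma cvg_invmx n (f : T -> 'M[R]_n) (A : 'M[R]_n) : A \in unitmx ->
  f @ F --> A -> invmx (f x) @[x --> F] --> invmx A.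
Proof.
move=> uA fA; have dA := uA; rewrite unitmxE unitfE in dA.
have cdet : \det (f x) @[x --> F] --> \det A by exact: cvg_det.
have adjA : (\det (f x))^-1 *: \adj (f x) @[x --> F] --> invmx A.
  rewrite /invmx uA; apply: cvgZ; first by apply: cvgV.
  apply: cvg_mx => i j; rewrite mxE; under eq_cvg do rewrite mxE.
  apply: cvgM; first exact: cvg_cst.
  apply: cvg_det; apply: cvg_mx => k l; rewrite !mxE.
  by under eq_cvg do rewrite !mxE; exact: cvg_coord.
have eqf : {near F, (fun x => (\det (f x))^-1 *: \adj (f x)) =1
                    (fun x => invmx (f x))}.
  near=> x; rewrite /invmx ifT// unitmxE unitfE.
  by near: x; exact: (cvgr_neq0 _ cdet).
move: adjA; apply: cvg_trans; apply: near_eq_cvg.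
by apply: filterS eqf.
Unshelve. all: by end_near. Qed.

End MatrixConvergence.

(** * Order statistics *)

Section OrderStatistics.
Context {R : realType} {m : nat}.
Implicit Types u v : 'rV[R]_m.+1.

(** The k-th largest coordinate of [u], for [0 < k <= m.+1]: the largest of the
    coordinates [u 0 i] for which at least k coordinates are [>= u 0 i]. *)
Definition ordstat (k : nat) u : R :=
  u 0 [arg max_(i > [arg min_(i < ord0) u 0 i]%O
       | (k <= #|[set j | (u 0 i <= u 0 j)%R]%SET|)%N) u 0 i]%O.

(** This equivalence determines the k-th largest coordinate; every other
    property of [ordstat] is read off from it. *)
Lemma ordstat_geP k u (r : R) : (0 < k <= m.+1)%N ->
  (r <= ordstat k u) = (k <= #|[set j | (r <= u 0 j)%R]%SET|)%N.
Proof.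
move=> /andP[k0 km]; rewrite /ordstat.
have P0 : (k <= #|[set j | (u 0 [arg min_(i < ord0) u 0 i]%O <= u 0 j)%R]%SET|)%N.
  case: arg_minP => // i _ mini.
  rewrite (_ : [set j | _]%SET = [set: 'I_m.+1]%SET) ?cardsT ?card_ord//.
  by apply/setP => j; rewrite !inE mini.
case: arg_maxP => // i Pi maxi; apply/idP/idP => [ri|kr].
  apply: leq_trans Pi _; apply: subset_leq_card; apply/fintype.subsetP => j.
  by rewrite !inE; exact: le_trans.
have /card_gt0P[j0 j0r] : (0 < #|[set j | (r <= u 0 j)%R]%SET|)%N
  by exact: leq_trans kr.
pose j := [arg min_(j < j0 | j \in [set j | (r <= u 0 j)%R]%SET) u 0 j]%O.
have [jr jmin] : r <= u 0 j /\ (forall l, r <= u 0 l -> u 0 j <= u 0 l).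
  rewrite /j; case: arg_minP => // l; rewrite inE => rl minl; split=> // p rp.
  by apply: minl; rewrite inE.
apply: le_trans jr (maxi _ _); apply: leq_trans kr _.
by apply: subset_leq_card; apply/fintype.subsetP => l; rewrite !inE; exact: jmin.
Qed.

Section Theory.
Context (k : nat) (hk : (0 < k <= m.+1)%N).

Lemma ordstat_count u : (k <= #|[set j | (ordstat k u <= u 0 j)%R]%SET|)%N.
Proof. by rewrite -ordstat_geP. Qed.

Lemma ordstat_uniq u v :
  (forall r, #|[set j | (r <= u 0 j)%R]%SET| = #|[set j | (r <= v 0 j)%R]%SET|) ->
  ordstat k u = ordstat k v.
Proof.
move=> uv; apply/eqP; rewrite eq_le; apply/andP.
by split; rewrite ordstat_geP//; [rewrite -uv|rewrite uv]; exact: ordstat_count.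
Qed.

Lemma ordstat_col_perm s u : ordstat k (col_perm s u) = ordstat k u.
Proof.
apply: ordstat_uniq => r.
rewrite -(card_imset _ (@perm_inj _ s)); congr #|pred_of_set _|.
apply/setP => j; rewrite inE; apply/imsetP/idP => [[i]|rj].
  by rewrite inE mxE => ? ->.
by exists ((s^-1)%g j); rewrite ?inE ?mxE permKV.
Qed.

Lemma ordstatZ u (a : R) : 0 < a -> ordstat k (a *: u) = a * ordstat k u.
Proof.
move=> a0.
have scale r : (r <= ordstat k (a *: u)) = (a^-1 * r <= ordstat k u).
  rewrite !ordstat_geP//; congr (_ <= #|pred_of_set _|)%N.
  by apply/setP => j; rewrite !inE mxE ler_pdivrMl.
apply/eqP; rewrite eq_le scale mulrA mulVf ?gt_eqF// mul1r lexx andbT.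
by rewrite -ler_pdivrMl// -scale.
Qed.

(** Order statistics are 1-Lipschitz for the sup norm: a lower bound shared by k
    coordinates of [u] survives, lowered by e, in [v]. *)
Lemma ordstat_lip u v (e : R) : (forall j, u 0 j - e <= v 0 j) ->
  ordstat k u - e <= ordstat k v.
Proof.
move=> uv; rewrite ordstat_geP//; apply: leq_trans (ordstat_count u) _.
apply: subset_leq_card; apply/fintype.subsetP => j; rewrite !inE => uj.
by apply: le_trans (uv j); rewrite lerB.
Qed.

Lemma cvg_ordstat (T : Type) (F : set_system T) (FF : Filter F)
    (f : T -> 'rV[R]_m.+1) u :
  f @ F --> u -> ordstat k (f x) @[x --> F] --> ordstat k u.
Proof.
move=> fu; apply/cvgrPdist_le => e e0.
have : \forall x \near F, forall j, `|u 0 j - f x 0 j| <= e.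
  apply: filter_forall => j.
  by have /cvgrPdist_le/(_ _ e0) := cvg_coord (i := 0) (j := j) fu.
apply: filterS => x ufx; rewrite ler_distlC; apply/andP; split.
  by apply: ordstat_lip => j; have := ufx j; rewrite ler_distlC => /andP[].
rewrite -lerBlDr; apply: ordstat_lip => j.
by have := ufx j; rewrite ler_distl => /andP[].
Qed.

Lemma ordstat_gt0 u :
  (0 < ordstat k u) = (k <= #|[set j | (0 < u 0 j)%R]%SET|)%N.
Proof.
apply/idP/idP => [c0|k0].
  apply: leq_trans (ordstat_count u) _; apply: subset_leq_card.
  by apply/fintype.subsetP => j; rewrite !inE; exact: lt_le_trans.
have /card_gt0P[j0 j0r] : (0 < #|[set j | (0 < u 0 j)%R]%SET|)%N.
  by apply: leq_trans k0; case/andP: hk.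
pose j := [arg min_(j < j0 | j \in [set j | (0 < u 0 j)%R]%SET) u 0 j]%O.
have [jr jmin] : 0 < u 0 j /\ (forall l, 0 < u 0 l -> u 0 j <= u 0 l).
  rewrite /j; case: arg_minP => // l; rewrite inE => rl minl; split=> // p rp.
  by apply: minl; rewrite inE.
apply: lt_le_trans jr _; rewrite ordstat_geP//; apply: leq_trans k0 _.
by apply: subset_leq_card; apply/fintype.subsetP => l; rewrite !inE; exact: jmin.
Qed.

End Theory.

Lemma ordstat_min u i : (forall j, u 0 i <= u 0 j) -> ordstat m.+1 u = u 0 i.
Proof.
move=> mini; apply/eqP; rewrite eq_le; apply/andP; split; last first.
  rewrite ordstat_geP ?leqnn//= -[X in (X <= _)%N](card_ord m.+1) -cardsT.
  by apply: subset_leq_card; apply/fintype.subsetP => j; rewrite !inE mini.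
have := @ordstat_count m.+1 _ u; rewrite leqnn/= => /(_ isT) full.
have /setP/(_ i) : [set j | (ordstat m.+1 u <= u 0 j)%R]%SET = [set: _]%SET.
  by apply/eqP; rewrite eqEcard finset.subsetT cardsT card_ord full.
by rewrite !inE.
Qed.

End OrderStatistics.

(** * Linear embeddings and affine dependencies *)

Section Dependencies.
Context {R : realType}.

Definition dependency m n (x : 'M[R]_(m, n)) (u : 'rV[R]_m) : Prop :=
  \sum_i u 0 i = 0 /\ u *m x = 0.

Definition npos m (u : 'rV[R]_m) : nat := #|[set j | (0 < u 0 j)%R]%SET|.

Lemma npos_gt0 m (u : 'rV[R]_m) : \sum_i u 0 i = 0 -> u != 0 -> (0 < npos u)%N.
Proof.
move=> su0 u0; rewrite lt0n; apply: contra u0 => /eqP/cards0_eq/setP pos0.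
have nu i : u 0 i <= 0.
  by have := pos0 i; rewrite !inE ltNge => /negbFE.
apply/eqP/rowP => i; rewrite mxE; apply/eqP.
have := @psumr_eq0P _ _ predT (fun i => - u 0 i).
move=> /(_ _ _ i isT)/eqP; rewrite oppr_eq0; apply.
- by move=> j _; rewrite oppr_ge0.
- by rewrite sumrN su0 oppr0.
Qed.

Lemma nposZ m (a : R) (u : 'rV[R]_m) : 0 < a -> npos (a *: u) = npos u.
Proof.
move=> a0; congr #|pred_of_set _|; apply/setP => j.
by rewrite !inE mxE pmulr_rgt0.
Qed.

Lemma nposN_disjoint m (u : 'rV[R]_m) : (npos u + npos (- u) <= m)%N.
Proof.
rewrite -cardsUI (_ : (_ :&: _ = finset.set0)%SET) ?cards0 ?addn0.
  by rewrite -[leqRHS]card_ord max_card.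
apply/setP => j; rewrite !inE mxE oppr_gt0; apply/negbTE/negP => /andP[h1 h2].
by have := lt_trans h1 h2; rewrite ltxx.
Qed.

Lemma dependencyZ m n (x : 'M[R]_(m, n)) (a : R) u :
  dependency x u -> dependency x (a *: u).
Proof.
move=> [su ux]; split; last by rewrite -scalemxAl ux scaler0.
by under eq_bigr do rewrite mxE; rewrite -mulr_sumr su mulr0.
Qed.

Lemma dependencyN m n (x : 'M[R]_(m, n)) u :
  dependency x u -> dependency x (- u).
Proof. by rewrite -scaleN1r; exact: dependencyZ. Qed.

Lemma dependencyD m n (x : 'M[R]_(m, n)) u v :
  dependency x u -> dependency x v -> dependency x (u + v).
Proof.
move=> [su ux] [sv vx]; split; last by rewrite mulmxDl ux vx addr0.
by under eq_bigr do rewrite mxE; rewrite big_split/= su sv addr0.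
Qed.

Lemma pos_part_sub (a : R) : Num.max a 0 - Num.max (- a) 0 = a.
Proof. by rewrite /Num.max oppr_lt0; case: ltgtP => a0; lra. Qed.

(** Peeling off one vertex at a time, a map that respects convex combinations
    of two points respects all barycentric combinations. *)
Lemma affine_on_simplex m n (s : {set 'I_m}) (f : 'rV[R]_m -> 'rV[R]_n)
    (x : 'M[R]_(m, n)) :
  (forall w w', closed_simplex s w -> closed_simplex s w' ->
     forall t : R, 0 <= t <= 1 ->
       f ((1 - t) *: w + t *: w') = (1 - t) *: f w + t *: f w') ->
  (forall i, f (delta_mx 0 i) = row i x) ->
  forall w, closed_simplex s w -> f w = w *m x.
Proof.
move=> faff fx w; have [k] := ubnP (npos w); elim: k w => // k IH w.
rewrite ltnS => wk [w0 ws w1].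
have [i wi] : exists i, 0 < w 0 i.
  apply/existsP; apply: contraT; rewrite negb_exists => /forallP nw.
  have : \sum_i w 0 i <= 0 by apply: sumr_le0 => i _; rewrite leNgt.
  by rewrite w1 ler10.
have is_ : i \in s.
  by apply/negPn/negP => /ws wi0; rewrite wi0 ltxx in wi.
have delta_s : closed_simplex s (delta_mx 0 i : 'rV[R]_m).
  split=> [j|j js|]; first by rewrite mxE ler0n.
    by rewrite mxE eqxx; case: eqP => // ji; rewrite ji is_ in js.
  by rewrite (bigD1 i)//= mxE !eqxx big1 ?addr0// => j /negbTE ji; rewrite mxE ji.
have sumE : \sum_j w 0 j = w 0 i + \sum_(j | j != i) w 0 j by rewrite (bigD1 i).
have wi1 : w 0 i <= 1.
  by rewrite -w1 sumE lerDl sumr_ge0.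
have [wiE|wi_neq1] := eqVneq (w 0 i) 1.
  have wE : w = delta_mx 0 i.
    apply/rowP => j; rewrite mxE eqxx/=; case: eqP => [->//|/eqP ji].
    have s0 : \sum_(j | j != i) w 0 j = 0 by move: sumE; rewrite w1 wiE; lra.
    exact: (psumr_eq0P _ s0).
  by rewrite wE fx -rowE.
have wi_lt1 : w 0 i < 1 by rewrite lt_neqAle wi_neq1.
have sub0 : 1 - w 0 i != 0 by rewrite subr_eq0 eq_sym.
pose w' := (1 - w 0 i)^-1 *: (w - w 0 i *: delta_mx 0 i).
have w'E j : w' 0 j = (1 - w 0 i)^-1 * (if j == i then 0 else w 0 j).
  by rewrite !mxE eqxx/=; case: eqP => [->|_]; rewrite ?mulr1 ?subrr ?mulr0 ?subr0.
have wE : w = (1 - w 0 i) *: w' + w 0 i *: delta_mx 0 i.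
  by rewrite scalerA divff// scale1r subrK.
have w's : closed_simplex s w'.
  split=> [j|j js|].
  - by rewrite w'E mulr_ge0// ?invr_ge0 ?subr_ge0//; case: ifP.
  - by rewrite w'E (ws j)//; case: ifP; rewrite mulr0.
  - under eq_bigr do rewrite w'E; rewrite -mulr_sumr (bigD1 i)//= eqxx add0r.
    rewrite (eq_bigr (fun j => w 0 j)); last by move=> j /negbTE ->.
    have -> : \sum_(j | j != i) w 0 j = 1 - w 0 i by move: sumE; rewrite w1; lra.
    by rewrite mulVf.
have fw' : f w' = w' *m x.
  apply: IH => //; apply: leq_trans wk; apply: proper_card; apply/properP.
  split; last by exists i; rewrite !inE ?wi// w'E eqxx mulr0 ltxx.
  apply/fintype.subsetP => j; rewrite !inE w'E.
  case: ifP => _; first by rewrite mulr0 ltxx.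
  by rewrite pmulr_rgt0// invr_gt0 subr_gt0.
rewrite [in LHS]wE faff// ?(ltW wi) ?wi1// fw' fx [in RHS]wE mulmxDl.
by rewrite -!scalemxAl -rowE.
Qed.

(** A failure of injectivity is, up to scaling, an affine dependency whose
    positive and negative parts are both carried by faces, that is, by at most
    n - 1 vertices each. *)
Lemma embedding_spaceP n (x : 'M[R]_(n.+2, n)) : (2 < n)%N ->
  embedding_space R n x <->
  forall u, dependency x u -> u != 0 -> (n <= npos u)%N || (n <= npos (- u))%N.
Proof.
move=> hn; have n1 : (n - 2).+1 = n.-1 by rewrite -subSn ?subSS ?subn1// ltnW.
have n0 : (0 < n)%N by apply: leq_trans hn.
split=> [[f [finj faff] fx] u [su ux] u0|lop].
  apply: contraT; rewrite negb_or -!ltnNge => /andP[up un].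
  have su' : \sum_i (- u) 0 i = 0.
    by under eq_bigr do rewrite mxE; rewrite sumrN su oppr0.
  pose P (v : 'rV[R]_n.+2) : {set 'I_n.+2} := [set j | (0 < v 0 j)%R]%SET.
  have Ks (v : 'rV[R]_n.+2) : \sum_i v 0 i = 0 -> v != 0 -> (npos v < n)%N ->
      P v \in skeleton (n - 2) n.+1.
    move=> sv v0 vn; rewrite inE npos_gt0//= n1 -ltnS prednK//.
  pose S : R := \sum_i Num.max (u 0 i) 0.
  have SN : \sum_i Num.max ((- u) 0 i) 0 = S.
    apply/esym/eqP; rewrite -subr_eq0 -sumrB -[X in _ == X]su.
    by apply/eqP; apply: eq_bigr => i _; rewrite mxE pos_part_sub.
  have S0 : 0 < S.
    have /card_gt0P[i] := npos_gt0 su u0; rewrite inE => ui.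
    rewrite /S (bigD1 i)//= (max_l (ltW ui)) ltr_pwDl// sumr_ge0// => j _.
    by rewrite le_max lexx orbT.
  (* The normalized positive parts of u and - u are distinct points of the
     realization with the same image. *)
  pose w (v : 'rV[R]_n.+2) : 'rV[R]_n.+2 := S^-1 *: \row_i Num.max (v 0 i) 0.
  have ws (v : 'rV[R]_n.+2) : \sum_i Num.max (v 0 i) 0 = S -> closed_simplex (P v) (w v).
    move=> vS; split=> [i|i|].
    - by rewrite !mxE mulr_ge0 ?invr_ge0 ?(ltW S0)// le_max lexx orbT.
    - by rewrite inE -leNgt !mxE => vi; rewrite (max_r vi) mulr0.
    - under eq_bigr do rewrite !mxE; rewrite -mulr_sumr vS mulVf// gt_eqF//.
  have Nu0 : - u != 0 by rewrite oppr_eq0.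
  have subE : w u - w (- u) = S^-1 *: u.
    by apply/rowP => i; rewrite !mxE -mulrBr pos_part_sub.
  have weq : w u = w (- u).
    apply: finj.
    - by rewrite inE; exists (P u); [exact: Ks|exact: ws].
    - by rewrite inE; exists (P (- u)); [exact: Ks|exact: ws].
    - rewrite (affine_on_simplex (faff _ (Ks _ su u0 up)) fx (ws _ (erefl _))).
      rewrite (affine_on_simplex (faff _ (Ks _ su' Nu0 un)) fx (ws _ SN)).
      by apply/eqP; rewrite -subr_eq0 -mulmxBl subE -scalemxAl ux scaler0.
  move/eqP: weq; rewrite -subr_eq0 subE scaler_eq0 invr_eq0 (gt_eqF S0)/=.
  by rewrite (negbTE u0).
exists (mulmx^~ x); last by move=> i; rewrite -rowE.
split=> [w w'|s sK w w' _ _ t _]; last by rewrite mulmxDl -!scalemxAl.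
rewrite !inE => -[s sK [w0 ws w1]] [s' s'K [w'0 w's' w'1]] wx.
apply/eqP; rewrite -subr_eq0; apply: contraT => u0.
have small (t : {set 'I_n.+2}) (v v' : 'rV[R]_n.+2) : t \in skeleton (n - 2) n.+1 ->
    (forall i, i \notin t -> v 0 i = 0) -> (forall i, 0 <= v' 0 i) ->
    (npos (v - v') < n)%N.
  rewrite inE n1 => /andP[_ tn] vt v'0.
  suff : (npos (v - v') <= n.-1)%N by rewrite -ltnS prednK.
  apply: leq_trans tn; apply: subset_leq_card; apply/fintype.subsetP => i.
  rewrite !inE; apply: contraLR => /vt vi.
  by rewrite !mxE vi sub0r oppr_gt0 -leNgt.
have dw : dependency x (w - w').
  split; last by rewrite mulmxBl wx subrr.
  by under eq_bigr do rewrite !mxE; rewrite sumrB w1 w'1 subrr.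
have := lop _ dw u0.
rewrite opprB => /orP[]; rewrite leqNgt.
- by rewrite (small s w w').
- by rewrite (small s' w' w).
Qed.

Lemma dependency_row_perm m n (x : 'M[R]_(m, n)) s u :
  dependency (row_perm s x) u -> dependency x (col_perm s^-1 u).
Proof.
move=> [su ux]; split.
  under eq_bigr do rewrite mxE; rewrite -[RHS]su.
  by rewrite [RHS](reindex_inj (@perm_inj _ s^-1%g)).
by rewrite col_permE invgK -mulmxA -row_permE.
Qed.

Lemma npos_col_perm m (u : 'rV[R]_m) s : npos (col_perm s u) = npos u.
Proof.
rewrite /npos -(card_imset _ (@perm_inj _ s)); congr #|pred_of_set _|.
apply/setP => j; rewrite inE; apply/imsetP/idP => [[i]|rj].
  by rewrite inE mxE => ? ->.
by exists ((s^-1)%g j); rewrite ?inE ?mxE permKV.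
Qed.

Lemma embedding_space_perm n (x : 'M[R]_(n.+2, n)) s : (2 < n)%N ->
  embedding_space R n x -> embedding_space R n (row_perm s x).
Proof.
move=> hn /(embedding_spaceP _ hn) lop; apply/embedding_spaceP => // u.
move=> /dependency_row_perm/lop; rewrite -(npos_col_perm u s^-1) -(npos_col_perm (- u) s^-1).
rewrite (_ : col_perm _ (- u) = - col_perm s^-1 u); last first.
  by apply/rowP => i; rewrite !mxE.
move=> uh u0; apply: uh; apply: contra u0 => /eqP/rowP u0.
by apply/eqP/rowP => i; have := u0 (s i); rewrite !mxE permK.
Qed.

End Dependencies.

(** * The dependency of an embedded configuration *)

Section LinearAlgebra.
Context {R : realType}.

Lemma mulmx_tr_eq0 m (w : 'rV[R]_m) : w *m w^T = 0 -> w = 0.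
Proof.
move=> /matrixP/(_ 0 0); rewrite !mxE => ww0; apply/rowP => i; rewrite mxE.
have ge0 k : true -> 0 <= w 0 k * w^T k 0 by rewrite mxE -expr2 sqr_ge0.
by have /(_ i isT)/eqP := psumr_eq0P ge0 ww0; rewrite mxE mulf_eq0 orbb => /eqP.
Qed.

Lemma gram_unit m n (A : 'M[R]_(m, n)) : row_full A -> A^T *m A \in unitmx.
Proof.
move=> fA; rewrite -row_free_unit -kermx_eq0; apply/rowV0P => v /sub_kermxP vAA.
have vA : v *m A^T = 0.
  by apply: mulmx_tr_eq0; rewrite trmx_mul trmxK mulmxA -(mulmxA v) vAA mul0mx.
have freeA : row_free A^T by rewrite /row_free mxrank_tr.
by apply/eqP; rewrite -(mulmx_free_eq0 _ freeA) vA.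
Qed.

End LinearAlgebra.

Section DependencyLine.
Context {R : realType} {n : nat}.
Hypothesis hn : (2 < n)%N.
Implicit Types (x : 'M[R]_(n.+2, n)) (u v : 'rV[R]_n.+2).

Lemma order_n : (0 < n <= n.+2)%N.
Proof. by rewrite (leq_trans _ hn)//= !leqW. Qed.

Local Notation c := (ordstat n).

Lemma ordstatN_le0 u : 0 < c u -> c (- u) <= 0.
Proof.
rewrite leNgt !(ordstat_gt0 order_n) -/(npos _) -/(npos _) => un.
apply/negP => Nun; have := nposN_disjoint u; rewrite leqNgt => /negP; apply.
by have := leq_add un Nun; apply: leq_trans; rewrite -addn2 ltn_add2l.
Qed.

(** An odd function of [u] that is nonzero on the dependencies of embedded
    configurations; multiplying by it removes the ambiguity of sign. *)
Definition gap u : R := c u - c (- u).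

Lemma gapN u : gap (- u) = - gap u.
Proof. by rewrite /gap opprK opprB. Qed.

Lemma gap_gt0 u : 0 < c u -> 0 < gap u.
Proof. by move=> u0; rewrite subr_gt0 (le_lt_trans (ordstatN_le0 u0)). Qed.

Lemma gapZ a u : gap (a *: u) = a * gap u.
Proof.
have pos b : 0 < b -> gap (b *: u) = b * gap u.
  by move=> b0; rewrite /gap -scalerN !(ordstatZ order_n)// mulrBr.
case: (ltgtP a 0) => [a0|/pos//|->]; last by rewrite scale0r mul0r /gap oppr0 subrr.
by rewrite -[a]opprK scaleNr gapN pos ?oppr_gt0// [RHS]mulNr.
Qed.

(** Homogeneous coordinates of the points: the left kernel of this matrix is the
    space of affine dependencies. *)
Definition homogeneous x : 'M[R]_(n.+2, 1 + n) := row_mx (const_mx 1) x.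

Lemma dependencyE x u : dependency x u <-> u *m homogeneous x = 0.
Proof.
have sumE : u *m const_mx 1 = (\sum_i u 0 i)%:M.
  apply/matrixP => i j; rewrite !ord1 !mxE eqxx mulr1n.
  by apply: eq_bigr => k _; rewrite mxE mulr1.
rewrite /homogeneous mul_mx_row sumE; split=> [[-> ->]|].
  by rewrite raddf0 row_mx0.
rewrite -[RHS](@row_mx0 _ 1 1 n) => /eq_row_mx[/matrixP/(_ 0 0) su ux].
by split=> //; move: su; rewrite !mxE eqxx mulr1n.
Qed.

Section Embedded.
Context {x} (xE : embedding_space R n x).

Lemma gap_dependency u : dependency x u -> u != 0 -> gap u != 0.
Proof.
move=> du u0; have /(embedding_spaceP _ hn)/(_ _ du u0) := xE.
rewrite -!(ordstat_gt0 order_n) => /orP[/gap_gt0/gt_eqF -> //|/gap_gt0].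
by rewrite gapN oppr_gt0 => /lt_eqF ->.
Qed.

(** Two independent dependencies u and v would give a path from u to - u through
    nonzero dependencies, and the odd function [gap] would vanish on it. *)
Lemma dependency_line u v : dependency x u -> u != 0 -> dependency x v ->
  exists a, v = a *: u.
Proof.
move=> du u0 dv; apply/not_existsP => indep.
pose g (t : R) : 'rV[R]_n.+2 := t *: u + (1 - t ^+ 2) *: v.
have g0 t : g t != 0.
  apply/eqP => gt0; have [t2|t2] := eqVneq (1 - t ^+ 2) 0.
    move/eqP: gt0; rewrite /g t2 scale0r addr0 scaler_eq0 (negbTE u0) orbF.
    by move=> /eqP t0; move: t2; rewrite t0 expr0n subr0 => /eqP; rewrite oner_eq0.
  apply: (indep (- ((1 - t ^+ 2)^-1 * t))).
  have gt : (1 - t ^+ 2) *: v = - (t *: u).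
    by apply/eqP; rewrite -subr_eq0 opprK addrC; exact/eqP.
  by rewrite -[v](scalerK t2) gt scalerN scalerA scaleNr.
have g1 : g 1 = u by rewrite /g expr1n subrr scale0r addr0 scale1r.
have gN1 : g (-1) = - u.
  by rewrite /g sqrrN expr1n subrr scale0r addr0 scaleN1r.
have cg (t : R) : g s @[s --> t] --> g t.
  apply: cvgD; first by apply: cvgZr_tmp; exact: cvg_id.
  apply: cvgZr_tmp; apply: cvgB; first exact: cvg_cst.
  by under eq_cvg do rewrite expr2; rewrite expr2; apply: cvgM; exact: cvg_id.
have cgap : continuous (fun t => gap (g t)).
  move=> t; apply: cvgB; first exact: (cvg_ordstat order_n) (cg t).
  by apply: (cvg_ordstat order_n); apply: cvgN; exact: cg.
have [t _ /eqP] : exists2 t, t \in `[-1, 1] & gap (g t) = 0.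
  apply: IVT; first by lra.
    exact: continuous_subspaceT.
  rewrite g1 gN1 gapN ge_min le_max.
  by case: (lerP 0 (gap u)) => h; rewrite ?oppr_le0 ?oppr_ge0 ?h ?(ltW h) ?orbT.
apply/negP; apply: gap_dependency => //.
by apply: dependencyD; exact: dependencyZ.
Qed.

Lemma dependency_exists : exists u, dependency x u /\ c u = 1.
Proof.
have : kermx (homogeneous x) != 0.
  rewrite kermx_eq0 /row_free neq_ltn; apply/orP; left.
  by rewrite (leq_ltn_trans (rank_leq_col _)).
move=> /rowV0Pn[u /sub_kermxP/dependencyE du u0].
wlog cu : u du u0 / 0 < c u.
  move=> wl; have := (embedding_spaceP _ hn).1 xE _ du u0.
  rewrite -!(ordstat_gt0 order_n) => /orP[|Nu]; first exact: wl.
  by apply: (wl (- u)); rewrite ?oppr_eq0//; exact: dependencyN.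
exists ((c u)^-1 *: u); split; first exact: dependencyZ.
by rewrite (ordstatZ order_n) ?invr_gt0// mulVf// gt_eqF.
Qed.

Lemma ordstat1_neq0 u : c u = 1 -> u != 0.
Proof.
move=> cu; apply/eqP => u0; have := @ordstatN_le0 u.
by rewrite u0 oppr0 -u0 cu ltr01 ler10 => /(_ isT).
Qed.

Lemma dependency_uniq u v :
  dependency x u -> c u = 1 -> dependency x v -> c v = 1 -> u = v.
Proof.
move=> du cu dv cv; have u0 := ordstat1_neq0 cu.
have [a vE] := dependency_line du u0 dv; move: cv; rewrite vE => cv.
have a0 : 0 < a.
  have := gap_gt0 (u := u); have := gap_gt0 (u := a *: u).
  by rewrite gapZ cu cv ltr01 => /(_ isT) + /(_ isT) g0; rewrite pmulr_lgt0.
by move: cv; rewrite (ordstatZ order_n)// cu mulr1 => ->; rewrite scale1r.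
Qed.

End Embedded.

(** The left kernel is a line, so the rank is n + 1. *)
Lemma homogeneous_full x : embedding_space R n x -> row_full (homogeneous x).
Proof.
move=> xE; have [u [du /ordstat1_neq0 u0]] := dependency_exists xE.
rewrite /row_full eqn_leq rank_leq_col/= -(leq_add2r 1) addnC add1n.
rewrite -leq_subLR -[leqLHS]/(n.+2 - _)%N -mxrank_ker.
rewrite (leq_trans _ (rank_leq_row u))//; apply: mxrankS.
apply/row_subP => i; have : row i (kermx (homogeneous x)) *m homogeneous x = 0.
  by apply/sub_kermxP; exact: row_sub.
move=> /dependencyE/(dependency_line xE du u0)[a ->].
exact: scalemx_sub.
Qed.

(** The orthogonal projection onto the line of dependencies. *)
Definition depproj x : 'M[R]_n.+2 :=
  let A := homogeneous x in 1%:M - A *m invmx (A^T *m A) *m A^T.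

(** All rows of the projection lie on one line, and each of them is weighted by
    its own [gap], which makes the sum independent of their signs. *)
Definition lam x : 'rV[R]_n.+2 :=
  let v := \sum_j gap (row j (depproj x)) *: row j (depproj x) in (c v)^-1 *: v.

Lemma lamP x : embedding_space R n x -> dependency x (lam x) /\ c (lam x) = 1.
Proof.
move=> xE; have [u [du cu]] := dependency_exists xE.
have u0 := ordstat1_neq0 cu.
have Aunit := gram_unit (homogeneous_full xE).
have PA : depproj x *m homogeneous x = 0.
  by rewrite mulmxBl mul1mx -[X in _ - X]mulmxA mulmxKV// subrr.
have rowE_ j : {a | row j (depproj x) = a *: u}.
  apply/cid/(dependency_line xE du u0).
  by apply/dependencyE; rewrite -row_mul PA row0.
pose a j := projT1 (rowE_ j).
have aE j : row j (depproj x) = a j *: u by exact: projT2 (rowE_ j).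
have gu : 0 < gap u by apply: gap_gt0; rewrite cu.
rewrite /lam; set v := \sum_j _.
have vE : v = ((\sum_j a j ^+ 2) * gap u) *: u.
  rewrite mulr_suml scaler_suml; apply: eq_bigr => j _.
  by rewrite aE gapZ scalerA mulrAC -expr2.
have a0 : 0 < \sum_j a j ^+ 2.
  rewrite lt_neqAle eq_sym sumr_ge0 ?andbT; last by move=> j _; rewrite sqr_ge0.
  apply: contra u0 => /eqP s0.
  have Pu : u *m depproj x = u.
    rewrite mulmxBr mulmx1 !mulmxA (dependencyE x u).1// !mul0mx subr0//.
  rewrite -Pu; apply/eqP; rewrite (_ : depproj x = 0) ?mulmx0//.
  apply/row_matrixP => j; rewrite aE row0.
  have ge0 k : true -> 0 <= a k ^+ 2 by rewrite sqr_ge0.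
  have /(_ j isT)/eqP := psumr_eq0P ge0 s0.
  by rewrite sqrf_eq0 => /eqP->; rewrite scale0r.
suff -> : (c v)^-1 *: v = u by [].
rewrite vE (ordstatZ order_n) ?mulr_gt0// cu mulr1 scalerA mulVf ?scale1r//.
by rewrite gt_eqF// mulr_gt0.
Qed.

(** The normalization [c u = 1] pins down both the scale and the sign. *)
Lemma lam_unique x u : embedding_space R n x ->
  dependency x u -> c u = 1 -> lam x = u.
Proof. by move=> xE du cu; have [? ?] := lamP xE; exact: (dependency_uniq xE). Qed.

Lemma lam_perm x s : embedding_space R n x ->
  lam (row_perm s x) = col_perm s (lam x).
Proof.
move=> xE; have [[sl lx] cl] := lamP xE; apply: lam_unique.
- exact: embedding_space_perm.
- split; first by under eq_bigr do rewrite mxE; rewrite -[RHS]sl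
    [RHS](reindex_inj (@perm_inj _ s)).
  rewrite col_permE row_permE -mulmxA (mulmxA (perm_mx _)) -perm_mxM mulVg.
  by rewrite perm_mx1 mul1mx.
- by rewrite ordstat_col_perm// order_n.
Qed.

Lemma cvg_lam (T : Type) (F : set_system T) (FF : Filter F)
    (f : T -> 'M[R]_(n.+2, n)) x :
  embedding_space R n x -> f @ F --> x -> lam (f y) @[y --> F] --> lam x.
Proof.
move=> xE fx.
have ch : homogeneous (f y) @[y --> F] --> homogeneous x.
  by apply: cvg_row_mx => //; exact: cvg_cst.
have cP : depproj (f y) @[y --> F] --> depproj x.
  apply: cvgB; first exact: cvg_cst.
  apply: cvg_mulmx; last exact: cvg_trmx.
  apply: cvg_mulmx => //; apply: cvg_invmx.
    exact/gram_unit/homogeneous_full.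
  by apply: cvg_mulmx => //; exact: cvg_trmx.
have crow j : row j (depproj (f y)) @[y --> F] --> row j (depproj x).
  apply: cvg_mx => i k; rewrite mxE; under eq_cvg do rewrite mxE.
  exact: cvg_coord.
have cv : \sum_j gap (row j (depproj (f y))) *: row j (depproj (f y)) @[y --> F]
      --> \sum_j gap (row j (depproj x)) *: row j (depproj x).
  apply: cvg_mx => i k; rewrite summxE; under eq_cvg do rewrite summxE.
  apply: cvg_sumr => j _; apply: cvg_coord; apply: cvgZ => //.
  apply: cvgB; first exact: (cvg_ordstat order_n).
  by apply: (cvg_ordstat order_n); exact: cvgN.
apply: cvgZ => //; apply: cvgV; last exact: (cvg_ordstat order_n).
have := (lamP xE).2; rewrite /lam; set v := \sum_j _.
apply: contra_eq_neq => ->; rewrite invr0 scale0r eq_sym.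
by apply: contra_eq_neq (oner_neq0 R) => /esym/ordstat1_neq0; rewrite eqxx.
Qed.

End DependencyLine.

(** * Deforming the dependency to a pyramidal one *)

Section PyramidalWeights.
Context {R : realType} {n : nat}.
Hypothesis hn : (2 < n)%N.
Implicit Types (u : 'rV[R]_n.+2) (v a : 'I_n.+2) (s : R).

Local Notation c := (ordstat n).
Local Notation nR := (n%:R : R).

(** The dependency of a pyramidal configuration with base [F], apex [v] and last
    vertex [a]: weight 1 on [F], and the weight [s] of [v] encodes the height
    of [a]. At [s = - n / 2] the heights of [v] and [a] are opposite, at [s = 1]
    the vertex [a] is the barycenter of the regular simplex on the others. *)
Definition pyramidal_weights u v a s : Prop :=
  [/\ v != a, - (nR / 2) <= s <= 1 &
      forall i, u 0 i = if i == a then - (nR + s) else if i == v then s else 1].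

Lemma card_others v a : v != a -> #|~: [set a; v]|%SET = n.
Proof. by move=> va; rewrite cardsCs finset.setCK card_ord cards2 eq_sym va subn2. Qed.

Lemma sum_weights (f : R -> R) u v a s : pyramidal_weights u v a s ->
  \sum_i f (u 0 i) = nR * f 1 + f s + f (- (nR + s)).
Proof.
move=> [va _ uE]; rewrite (bigD1 a)//= (bigD1 v)//= !uE !eqxx (negbTE va).
rewrite (eq_bigr (fun=> f 1)); last first.
  by move=> i /andP[/negbTE ia /negbTE iv]; rewrite uE ia iv.
rewrite sumr_const (_ : #|_| = n); last first.
  have -> : #|[pred i | (i != a) && (i != v)]| = #|~: [set a; v]|%SET.
    by apply: eq_card => i; rewrite !inE negb_or.
  exact: card_others.
by rewrite mulr_natl; ring.
Qed.

Lemma nR_gt2 : 2 < nR. Proof. by rewrite ltr_nat. Qed.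

Lemma weights_sum0 u v a s : pyramidal_weights u v a s -> \sum_i u 0 i = 0.
Proof. by move=> /(sum_weights id) ->; ring. Qed.

Lemma weights_le1 u v a s : pyramidal_weights u v a s -> forall i, u 0 i <= 1.
Proof.
move=> [_ s1 uE] i; rewrite uE; have := nR_gt2.
by case: eqP => _; last case: eqP => _; lra.
Qed.

Lemma weights_min u v a s : pyramidal_weights u v a s -> forall i, u 0 a <= u 0 i.
Proof.
move=> [_ s1 uE] i; rewrite !uE eqxx; have := nR_gt2.
by case: eqP => _; last case: eqP => _; lra.
Qed.

Lemma weights_ordstat1 u v a s : pyramidal_weights u v a s -> c u = 1.
Proof.
move=> uw; have [va s1 uE] := uw; apply/eqP; rewrite eq_le; apply/andP; split.
  rewrite leNgt; apply/negP => c1.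
  have := ordstat_count (order_n hn) u.
  rewrite (_ : [set j | _]%SET = finset.set0) ?cards0; last first.
    apply/setP => j; rewrite !inE; apply/negbTE; rewrite -ltNge.
    by apply: le_lt_trans c1; exact: weights_le1 uw j.
  by rewrite leqNgt (ltn_trans _ hn).
rewrite (ordstat_geP _ _ (order_n hn)).
rewrite -[X in (X <= _)%N](card_others va).
apply: subset_leq_card; apply/fintype.subsetP => i; rewrite !inE negb_or.
by move=> /andP[/negbTE ia /negbTE iv]; rewrite uE ia iv.
Qed.

(** [cap] cuts the positive weights off at 1 and rescales the negative ones by
    this ratio, so that the sum stays zero. *)
Definition cap_ratio u : R :=
  (\sum_i Num.min (Num.max (u 0 i) 0) 1) / \sum_i Num.max (u 0 i) 0.

Definition cap u : 'rV[R]_n.+2 :=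
  \row_i (Num.min (Num.max (u 0 i) 0) 1 + cap_ratio u * Num.min (u 0 i) 0).

Lemma cap_col_perm (s : 'S_n.+2) u : cap (col_perm s u) = col_perm s (cap u).
Proof.
have sumE (f : R -> R) : \sum_i f (col_perm s u 0 i) = \sum_i f (u 0 i).
  by under eq_bigr do rewrite mxE; rewrite [RHS](reindex_inj (@perm_inj _ s)).
apply/rowP => i; rewrite !mxE; congr (_ + _ * _); rewrite /cap_ratio.
by rewrite (sumE (fun r => Num.min (Num.max r 0) 1)) (sumE (Num.max ^~ 0)).
Qed.

Section Normalized.
Context {u} (su : \sum_i u 0 i = 0) (cu : c u = 1).

Lemma npos_normalized : (n <= npos u)%N.
Proof. by rewrite -(ordstat_gt0 (order_n hn)) cu. Qed.

Lemma sum_pos_gt0 : 0 < \sum_i Num.max (u 0 i) 0.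
Proof.
have /card_gt0P[i] : (0 < npos u)%N.
  by apply: leq_trans npos_normalized; exact: leq_trans hn.
rewrite inE => ui; rewrite (bigD1 i)//= (max_l (ltW ui)) ltr_pwDl// sumr_ge0//.
by move=> j _; rewrite le_max lexx orbT.
Qed.

Lemma cap_ratio_gt0 : 0 < cap_ratio u.
Proof.
rewrite divr_gt0 ?sum_pos_gt0//.
have /card_gt0P[i] : (0 < npos u)%N.
  by apply: leq_trans npos_normalized; exact: leq_trans hn.
rewrite inE => ui; rewrite (bigD1 i)//= (max_l (ltW ui)) ltr_pwDl//.
  by rewrite lt_min ui ltr01.
by rewrite sumr_ge0// => j _; rewrite le_min le_max lexx ler01 orbT.
Qed.

Lemma cap_sum0 : \sum_i cap u 0 i = 0.
Proof.
under eq_bigr do rewrite mxE; rewrite big_split/= -mulr_sumr.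
have -> : \sum_i Num.min (u 0 i) 0 = - \sum_i Num.max (u 0 i) 0.
  apply/eqP; rewrite -addr_eq0 -big_split/= -[X in _ == X]su; apply/eqP.
  by apply: eq_bigr => i _; rewrite /Num.min /Num.max; case: ifP; rewrite ?addr0 ?add0r.
by rewrite mulrN /cap_ratio divfK ?subrr// gt_eqF// sum_pos_gt0.
Qed.

Lemma cap_gt0 i : 0 < u 0 i -> 0 < cap u 0 i.
Proof.
move=> ui; rewrite mxE (max_l (ltW ui)) (min_r (ltW ui)) mulr0 addr0.
by rewrite lt_min ui ltr01.
Qed.

Lemma cap_le0 i : u 0 i <= 0 -> cap u 0 i <= 0.
Proof.
move=> ui; rewrite mxE (max_r ui) (min_l ui) (min_l ler01) add0r.
by rewrite pmulr_rle0// cap_ratio_gt0.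
Qed.

Lemma cap_homo i j : u 0 i <= u 0 j -> cap u 0 i <= cap u 0 j.
Proof.
move=> uij; rewrite !mxE lerD//.
  by apply: le_min2 => //; exact: le_max2.
by rewrite ler_pM2l ?cap_ratio_gt0//; exact: le_min2.
Qed.

(** At least n weights are [>= 1] and become 1. One of the other two is the least
    weight, which is negative; the bounds on the remaining one hold because [cap]
    is monotone and has values at most 1. *)
Lemma cap_weights : exists v a s, pyramidal_weights (cap u) v a s.
Proof.
pose S := [set j | (1 <= u 0 j)%R]%SET.
have Sn : (n <= #|S|)%N by rewrite -(ordstat_geP _ _ (order_n hn)) cu.
pose a := [arg min_(i < ord0) u 0 i]%O.
have mina i : u 0 a <= u 0 i by rewrite /a; case: arg_minP => // k _; apply.
have aS : a \notin S.
  rewrite inE -ltNge; apply: le_lt_trans ltr01; rewrite leNgt; apply/negP => ua.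
  have : 0 < \sum_i u 0 i.
    rewrite (bigD1 a)//= ltr_pwDl// sumr_ge0// => i _.
    by rewrite (le_trans (ltW ua)).
  by rewrite su ltxx.
have [v va vS] : exists2 v, v != a & forall i, i != a -> i != v -> i \in S.
  have : (#|~: S :\ a| <= 1)%N%SET.
    rewrite -(leq_add2l (a \in ~: S)%SET) -cardsD1 inE aS cardsCs finset.setCK.
    by rewrite card_ord leq_subLR addn2 !ltnS.
  rewrite leq_eqVlt ltnS leqn0 => /orP[/cards1P[v vE]|].
    exists v; first by have : v \in [set v]%SET by [rewrite inE]; rewrite -vE !inE => /andP[].
    move=> i ia iv; apply/negPn/negP => iS.
    have : i \in (~: S :\ a)%SET by rewrite in_setD1 ia finset.in_setC.
    by rewrite vE inE (negbTE iv).
  rewrite cards_eq0 => /eqP/setP S0.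
  have [v va] : exists v, v != a.
    apply/existsP; rewrite -[X in is_true X]negbK negb_exists.
    apply/negP => /forallP alla; have : (#|'I_n.+2| <= #|[set a]|)%N%SET.
      apply: subset_leq_card; apply/fintype.subsetP => i _.
      by have := alla i; rewrite negbK inE.
    by rewrite card_ord cards1.
  exists v => // i ia _; have := S0 i; rewrite in_setD1 ia finset.in_setC finset.in_set0/=.
  by move=> /negbT; rewrite negbK.
have capE i : i != a -> i != v -> cap u 0 i = 1.
  move=> ia iv; have := vS i ia iv; rewrite inE => ui.
  have ui0 : 0 <= u 0 i by apply: le_trans ui.
  by rewrite mxE (max_l ui0) (min_r ui0) (min_r ui) mulr0 addr0.
have capa : cap u 0 a = - (nR + cap u 0 v).
  have := cap_sum0; rewrite (bigD1 a)//= (bigD1 v)//=.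
  rewrite (eq_bigr (fun=> 1)); last by move=> i /andP[]; exact: capE.
  rewrite sumr_const (_ : #|_| = n); first by move=> ?; lra.
  have -> : #|[pred i | (i != a) && (i != v)]| = #|~: [set a; v]|%SET.
    by apply: eq_card => i; rewrite !inE negb_or.
  exact: card_others.
exists v, a, (cap u 0 v); split=> //.
  have := cap_homo (mina v); rewrite capa => h; apply/andP; split; first by lra.
  have : cap_ratio u * Num.min (u 0 v) 0 <= 0.
    by rewrite pmulr_rle0 ?cap_ratio_gt0// ge_min lexx orbT.
  have : Num.min (Num.max (u 0 v) 0) 1 <= 1 by rewrite ge_min lexx orbT.
  rewrite [in X in _ -> _ -> X]mxE; lra.
move=> i; case: eqP => [->//|/eqP ia]; case: eqP => [->//|/eqP iv].
exact: capE.
Qed.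

(** Nothing is cut off, so the ratio is 1. *)
Lemma cap_id : (forall i, u 0 i <= 1) -> cap u = u.
Proof.
move=> u1.
have minE i : Num.min (Num.max (u 0 i) 0) 1 = Num.max (u 0 i) 0.
  by apply: min_l; rewrite ge_max u1 ler01.
have r1 : cap_ratio u = 1.
  rewrite /cap_ratio; under eq_bigr do rewrite minE.
  by rewrite divff// gt_eqF// sum_pos_gt0.
apply/rowP => i; rewrite mxE r1 minE mul1r /Num.min /Num.max.
by case: ifP; rewrite ?addr0 ?add0r.
Qed.

(** Positive weights stay positive and the others stay nonpositive along this
    path, so it keeps n positive weights and never becomes orthogonal to [u]. *)
Definition cap_path (t : R) u : 'rV[R]_n.+2 := (1 - t) *: u + t *: cap u.

Lemma cap_pathE t i : cap_path t u 0 i = (1 - t) * u 0 i + t * cap u 0 i.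
Proof. by rewrite mxE; congr (_ + _); rewrite mxE. Qed.

Section Path.
Context {t : R} (t01 : 0 <= t <= 1).

Lemma cap_path_sum0 : \sum_i cap_path t u 0 i = 0.
Proof.
under eq_bigr do rewrite cap_pathE.
by rewrite big_split/= -!mulr_sumr su cap_sum0 !mulr0 addr0.
Qed.

Lemma cap_path_gt0 i : 0 < u 0 i -> 0 < cap_path t u 0 i.
Proof.
move=> ui; have := cap_gt0 ui => ci.
rewrite cap_pathE; have /andP[t0 t1] := t01.
have [->|tn1] := eqVneq t 1; first by rewrite subrr mul0r add0r mul1r.
rewrite ltr_wpDr ?mulr_ge0 ?(ltW ci)// mulr_gt0// subr_gt0 lt_neqAle tn1//.
Qed.

Lemma cap_path_le0 i : u 0 i <= 0 -> cap_path t u 0 i <= 0.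
Proof.
move=> ui; have := cap_le0 ui => ci; have /andP[t0 t1] := t01.
rewrite cap_pathE -oppr_ge0 opprD -!mulrN.
by rewrite addr_ge0// mulr_ge0// ?oppr_ge0// subr_ge0.
Qed.

Lemma npos_cap_path : (n <= npos (cap_path t u))%N.
Proof.
apply: leq_trans npos_normalized _; apply: subset_leq_card.
by apply/fintype.subsetP => i; rewrite !inE; exact: cap_path_gt0.
Qed.

Lemma cap_path_dot : 0 < dot (cap_path t u) u.
Proof.
have /card_gt0P[i] : (0 < npos u)%N.
  by apply: leq_trans npos_normalized; exact: leq_trans hn.
rewrite inE => ui; rewrite /dot (bigD1 i)//= ltr_pwDl ?mulr_gt0 ?cap_path_gt0//.
apply: sumr_ge0 => j _; case: (ltP 0 (u 0 j)) => uj.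
  by rewrite mulr_ge0 ?(ltW uj)// ltW// cap_path_gt0.
by rewrite mulr_le0// cap_path_le0.
Qed.

End Path.
End Normalized.

Lemma cvg_cap (T : Type) (F : set_system T) (FF : Filter F)
    (f : T -> 'rV[R]_n.+2) u : c u = 1 ->
  f @ F --> u -> cap (f y) @[y --> F] --> cap u.
Proof.
move=> cu fu.
have fi i : f y 0 i @[y --> F] --> u 0 i by exact: cvg_coord.
have cmax i : Num.max (f y 0 i) 0 @[y --> F] --> Num.max (u 0 i) 0.
  by apply: cvg_maxr => //; exact: cvg_cst.
have cmin i : Num.min (Num.max (f y 0 i) 0) 1 @[y --> F]
    --> Num.min (Num.max (u 0 i) 0) 1.
  by apply: cvg_minr => //; exact: cvg_cst.
apply: cvg_mx => i j; rewrite mxE; under eq_cvg do rewrite mxE.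
apply: cvgD => //; apply: cvgM; last by apply: cvg_minr => //; exact: cvg_cst.
apply: cvgM; first exact: cvg_sumr.
by apply: cvgV; [rewrite gt_eqF// sum_pos_gt0 | exact: cvg_sumr].
Qed.

End PyramidalWeights.

(** * Cholesky factors *)

Section Cholesky.
Context {R : realType}.

Definition posdef n (Q : 'M[R]_n) : Prop :=
  Q^T = Q /\ forall v : 'rV[R]_n, v != 0 -> 0 < (v *m Q *m v^T) 0 0.

Definition schur n (Q : 'M[R]_(1 + n)) : 'M[R]_n :=
  drsubmx Q - (Q 0 0)^-1 *: (dlsubmx Q *m (dlsubmx Q)^T).

(** The lower triangular factor with positive diagonal. A triangular factor,
    unlike the symmetric square root, is given by an explicit recursion, and the
    segment joining it to the identity consists of invertible matrices. *)
Fixpoint cholesky n : 'M[R]_n -> 'M[R]_n :=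
  if n is n'.+1 then fun Q : 'M[R]_(1 + n') =>
    block_mx (Num.sqrt (Q 0 0))%:M 0
             ((Num.sqrt (Q 0 0))^-1 *: dlsubmx Q) (cholesky (schur Q))
  else fun=> 1%:M.

Lemma posdef00 n (Q : 'M[R]_(1 + n)) : posdef Q -> 0 < Q 0 0.
Proof.
move=> [_ Qpos]; have := Qpos (delta_mx 0 0).
rewrite -rowE trmx_delta -colE !mxE; apply.
by apply/eqP => /matrixP/(_ 0 0); rewrite !mxE !eqxx; exact/eqP/oner_neq0.
Qed.

Lemma ulsubmx00 n (Q : 'M[R]_(1 + n)) : ulsubmx Q = (Q 0 0)%:M.
Proof.
apply/matrixP => i j; rewrite !ord1 !mxE eqxx mulr1n; congr (Q _ _); exact/val_inj.
Qed.

(** The value of the Schur complement at v is the value of Q at the vector (s, v)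
    for the s that minimizes it. *)
Lemma posdef_schur n (Q : 'M[R]_(1 + n)) : posdef Q -> posdef (schur Q).
Proof.
move=> Qp; have q0 := posdef00 Qp; have [Qsym Qpos] := Qp.
have ursE : ursubmx Q = (dlsubmx Q)^T by rewrite trmx_dlsub Qsym.
split.
  rewrite /schur linearB /= linearZ /= trmx_mul trmxK; congr (_ - _).
  by rewrite trmx_drsub Qsym.
move=> v v0; set b := dlsubmx Q.
pose p := (v *m b) 0 0; have vbE : v *m b = p%:M by exact: mx11_scalar.
pose s : R := - (Q 0 0)^-1 * p.
have w0 : row_mx (s%:M : 'M[R]_(1, 1)) v != 0.
  apply: contra v0 => /eqP; rewrite -[RHS](@row_mx0 _ 1 1 n) => /eq_row_mx[_ ->].
  by [].
have := Qpos _ w0; rewrite -[X in _ *m X *m _]submxK ulsubmx00 ursE -/b.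
rewrite mul_row_block tr_row_mx mul_row_col tr_scalar_mx !mulmxDl vbE.
have bvE : b^T *m v^T = p%:M by rewrite -trmx_mul vbE tr_scalar_mx.
rewrite -[s%:M *m b^T *m _]mulmxA bvE.
have -> : schur Q = drsubmx Q - (Q 0 0)^-1 *: (b *m b^T) by [].
rewrite mulmxBr mulmxBl -scalemxAr -scalemxAl.
rewrite [v *m (b *m _)]mulmxA -[_ *m b^T *m _]mulmxA bvE vbE -!scalar_mxM.
move: (v *m drsubmx Q *m v^T) => d; rewrite !mxE eqxx !mulr1n => h.
suff -> : d 0 0 - (Q 0 0)^-1 * (p * p) =
  s * Q 0 0 * s + p * s + (s * p + d 0 0) by [].
by rewrite /s; field; rewrite gt_eqF.
Qed.

Lemma choleskyP n (Q : 'M[R]_n) : posdef Q -> cholesky Q *m (cholesky Q)^T = Q.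
Proof.
elim: n Q => [|n IH] Q Qp; first by apply/matrixP => -[].
have q0 := posdef00 Qp; have [Qsym _] := Qp.
have q1 : Num.sqrt (Q 0 0) != 0 by rewrite gt_eqF// sqrtr_gt0.
rewrite /= (@tr_block_mx _ 1 n 1 n) (@mulmx_block _ 1 n 1 n 1 n) trmx0.
rewrite !mulmx0 !mul0mx !addr0 IH; last exact: posdef_schur.
rewrite -[RHS](@submxK _ 1 n 1 n) tr_scalar_mx -scalar_mxM -expr2.
rewrite sqr_sqrtr ?(ltW q0)// ulsubmx00.
rewrite linearZ /= mul_scalar_mx mul_mx_scalar !scalerA mulfV// !scale1r.
congr (@block_mx _ 1 n 1 n _ _ _ _); first by rewrite trmx_dlsub Qsym.
rewrite -scalemxAl -scalemxAr scalerA -invfM -expr2 sqr_sqrtr ?(ltW q0)//.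
by rewrite addrC subrK.
Qed.

Lemma cholesky1 n : cholesky (1%:M : 'M[R]_n) = 1%:M.
Proof.
elim: n => [//|n IH] /=.
have E : (1%:M : 'M[R]_(1 + n)) = block_mx 1%:M 0 0 1%:M by rewrite -scalar_mx_block.
rewrite /schur E block_mxKdl block_mxKdr mul0mx !scaler0 subr0 IH.
by rewrite -E mxE eqxx sqrtr1.
Qed.

(** A triangular matrix with positive diagonal is invertible, and this property
    is convex. *)
Lemma cholesky_segment_unit n (Q : 'M[R]_n) (t : R) : posdef Q -> 0 <= t <= 1 ->
  (1 - t)%:M + t *: cholesky Q \in unitmx.
Proof.
move=> Qp t01; rewrite unitmxE unitfE gt_eqF//.
elim: n Q Qp => [|n IH] Q Qp; first by rewrite det_mx00 ltr01.
have q0 : 0 < Num.sqrt (Q 0 0) by rewrite sqrtr_gt0 posdef00.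
rewrite /= (@scalar_mx_block _ 1 n) (@scale_block_mx _ 1 n 1 n) (@add_block_mx _ 1 n 1 n).
rewrite scaler0 !add0r (@det_lblock _ 1 n) mulr_gt0 ?IH//; last exact: posdef_schur.
rewrite scale_scalar_mx -raddfD /= det_scalar1.
move/andP: t01 => [t0 t1].
have [->|tn1] := eqVneq t 1; first by rewrite subrr add0r mul1r.
by rewrite ltr_wpDr ?mulr_ge0 ?(ltW q0)// subr_gt0 lt_neqAle tn1.
Qed.

Lemma cvg_cholesky (T : Type) (F : set_system T) (FF : Filter F) n
    (f : T -> 'M[R]_n) (Q : 'M[R]_n) :
  posdef Q -> f @ F --> Q -> cholesky (f y) @[y --> F] --> cholesky Q.
Proof.
elim: n f Q => [|n IH] f Q Qp fQ; first exact: cvg_cst.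
have q0 := posdef00 Qp.
have c00 : f y 0 0 @[y --> F] --> Q 0 0 by exact: cvg_coord.
have csq : Num.sqrt (f y 0 0) @[y --> F] --> Num.sqrt (Q 0 0).
  by apply: (cvg_comp _ _ c00); exact: sqrt_continuous.
have cdl : dlsubmx (f y : 'M[R]_(1 + n)) @[y --> F] --> dlsubmx (Q : 'M[R]_(1 + n)).
  apply: cvg_mx => i j; rewrite !mxE; under eq_cvg do rewrite !mxE.
  exact: cvg_coord.
have cdr : drsubmx (f y : 'M[R]_(1 + n)) @[y --> F] --> drsubmx (Q : 'M[R]_(1 + n)).
  apply: cvg_mx => i j; rewrite !mxE; under eq_cvg do rewrite !mxE.
  exact: cvg_coord.
have csch : cholesky (schur (f y)) @[y --> F] --> cholesky (schur Q).
  apply: IH; first exact: posdef_schur.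
  apply: cvgB => //; apply: cvgZ; first by apply: cvgV => //; rewrite gt_eqF.
  by apply: cvg_mulmx => //; exact: cvg_trmx.
have cl : (Num.sqrt (f y 0 0))^-1 *: dlsubmx (f y : 'M[R]_(1 + n)) @[y --> F]
    --> (Num.sqrt (Q 0 0))^-1 *: dlsubmx (Q : 'M[R]_(1 + n)).
  by apply: cvgZ => //; apply: cvgV => //; rewrite gt_eqF// sqrtr_gt0.
apply: (@cvg_col_mx _ _ _ _ 1 n (1 + n)); last exact: (@cvg_row_mx _ _ _ _ n 1 n).
apply: (@cvg_row_mx _ _ _ _ 1 1 n); last exact: cvg_cst.
apply: cvg_mx => i j; rewrite mxE; under eq_cvg do rewrite mxE.
by case: (i == j); [exact: csq | exact: cvg_cst].
Qed.

End Cholesky.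

(** * Frames of the space orthogonal to a dependency *)

Section Frames.
Context {R : realType} {n : nat}.
Hypothesis hn : (2 < n)%N.
Implicit Types (x : 'M[R]_(n.+2, n)) (u l w : 'rV[R]_n.+2).

Local Notation one := (const_mx 1 : 'rV[R]_n.+2).

Lemma mulmx_trE m (u w : 'rV[R]_m) : u *m w^T = (dot u w)%:M.
Proof.
apply/matrixP => i j; rewrite !ord1 !mxE eqxx mulr1n.
by apply: eq_bigr => k _; rewrite mxE.
Qed.

Lemma mulmx_gram m p (u : 'rV[R]_m) (A : 'M[R]_(m, p)) :
  u *m (A *m A^T) *m u^T = (dot (u *m A) (u *m A))%:M.
Proof. by rewrite -mulmx_trE trmx_mul !mulmxA. Qed.

Lemma dotC m (u w : 'rV[R]_m) : dot u w = dot w u.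
Proof. by apply: eq_bigr => k _; rewrite mulrC. Qed.

Lemma dotDl m (u1 u2 w : 'rV[R]_m) : dot (u1 + u2) w = dot u1 w + dot u2 w.
Proof. by rewrite -big_split; apply: eq_bigr => k _; rewrite mxE mulrDl. Qed.

Lemma dotZl m a (u w : 'rV[R]_m) : dot (a *: u) w = a * dot u w.
Proof. by rewrite mulr_sumr; apply: eq_bigr => k _; rewrite mxE mulrA. Qed.

Lemma dotNl m (u w : 'rV[R]_m) : dot (- u) w = - dot u w.
Proof. by rewrite -scaleN1r dotZl mulN1r. Qed.

Lemma dotBl m (u1 u2 w : 'rV[R]_m) : dot (u1 - u2) w = dot u1 w - dot u2 w.
Proof. by rewrite dotDl dotNl. Qed.

Lemma dotBr m (u1 u2 w : 'rV[R]_m) : dot w (u1 - u2) = dot w u1 - dot w u2.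
Proof. by rewrite dotC dotBl !(dotC w). Qed.

Lemma dot_ge0 m (u : 'rV[R]_m) : 0 <= dot u u.
Proof. by apply: sumr_ge0 => k _; rewrite -expr2 sqr_ge0. Qed.

Lemma dot_eq0 m (u : 'rV[R]_m) : (dot u u == 0) = (u == 0).
Proof.
apply/eqP/eqP => [u0|->]; first by apply: mulmx_tr_eq0; rewrite mulmx_trE u0 raddf0.
by rewrite /dot big1// => k _; rewrite mxE mul0r.
Qed.

Lemma dot_gt0 m (u : 'rV[R]_m) : (0 < dot u u) = (u != 0).
Proof. by rewrite lt_neqAle dot_ge0 andbT eq_sym dot_eq0. Qed.

Lemma dot_one u : dot u one = \sum_i u 0 i.
Proof. by apply: eq_bigr => k _; rewrite mxE mulr1. Qed.

(** [meanmx *m x] has the barycenter of the rows of [x] in every row. *)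
Definition meanmx : 'M[R]_n.+2 := const_mx n.+2%:R^-1.

(** The orthogonal projection onto the vectors orthogonal to [l] and to the
    constant vector, when the sum of the coordinates of [l] is zero. *)
Definition hyper l : 'M[R]_n.+2 := 1%:M - meanmx - (dot l l)^-1 *: (l^T *m l).

Lemma mul_meanmx u : u *m meanmx = ((\sum_i u 0 i) / n.+2%:R) *: one.
Proof.
apply/rowP => j; rewrite !mxE mulr1 mulr_suml.
by apply: eq_bigr => k _; rewrite mxE.
Qed.

Lemma mul_hyper w l :
  w *m hyper l = w - ((\sum_i w 0 i) / n.+2%:R) *: one - (dot w l / dot l l) *: l.
Proof.
rewrite !mulmxBr mulmx1 mul_meanmx -scalemxAr mulmxA mulmx_trE mul_scalar_mx.
by rewrite scalerA [(dot l l)^-1 * _]mulrC.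
Qed.

Lemma tr_meanmx : meanmx^T = meanmx.
Proof. by apply/matrixP => i j; rewrite !mxE. Qed.

Lemma tr_hyper l : (hyper l)^T = hyper l.
Proof.
by rewrite /hyper !linearB /= linearZ /= trmx_mul trmxK trmx1 tr_meanmx.
Qed.

Lemma one_meanmx : one *m meanmx = one.
Proof.
rewrite mul_meanmx -dot_one /dot.
under eq_bigr do rewrite !mxE mulr1.
by rewrite sumr_const card_ord divff ?scale1r// pnatr_eq0.
Qed.

Section Hyper.
Context {l} (sl : \sum_i l 0 i = 0) (l0 : l != 0).

Lemma dot_l_one : dot l one = 0. Proof. by rewrite dot_one. Qed.

Lemma one_hyper : one *m hyper l = 0.
Proof.
by rewrite mul_hyper -mul_meanmx one_meanmx subrr dotC dot_l_one mul0r scale0r subr0.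
Qed.

Lemma l_hyper : l *m hyper l = 0.
Proof.
rewrite mul_hyper sl mul0r scale0r subr0 divff ?dot_eq0// scale1r subrr//.
Qed.

Lemma dot_hyper_one w : dot (w *m hyper l) one = 0.
Proof.
have /matrixP/(_ 0 0) : (w *m hyper l) *m one^T = 0.
  by rewrite -mulmxA -[hyper l]tr_hyper -trmx_mul one_hyper trmx0 mulmx0.
by rewrite mulmx_trE !mxE eqxx mulr1n.
Qed.

Lemma dot_hyper_l w : dot (w *m hyper l) l = 0.
Proof.
have /matrixP/(_ 0 0) : (w *m hyper l) *m l^T = 0.
  by rewrite -mulmxA -[hyper l]tr_hyper -trmx_mul l_hyper trmx0 mulmx0.
by rewrite mulmx_trE !mxE eqxx mulr1n.
Qed.

Lemma hyper_id : hyper l *m hyper l = hyper l.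
Proof.
apply/row_matrixP => i; rewrite row_mul mul_hyper.
rewrite -dot_one rowE dot_hyper_one mul0r scale0r subr0.
by rewrite dot_hyper_l mul0r scale0r subr0.
Qed.

Section Projected.
Context {x} (xE : embedding_space R n x) (ll : dot l (lam x) != 0).

(** Projecting along [l] loses nothing as long as [l] is not orthogonal to the
    dependency of [x]. *)
Lemma hyper_mul_eq0 w : w *m hyper l *m x = 0 -> w *m hyper l = 0.
Proof.
move=> wx; have [dl cl] := lamP hn xE.
have dw : dependency x (w *m hyper l).
  by split=> //; rewrite -dot_one dot_hyper_one.
have [a wE] := dependency_line hn xE dl (ordstat1_neq0 hn cl) dw.
have := dot_hyper_l w; rewrite wE dotZl dotC => /eqP.
by rewrite mulf_eq0 (negbTE ll) orbF => /eqP ->; rewrite scale0r.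
Qed.

Lemma hyper_ker w : \sum_i w 0 i = 0 -> w *m (hyper l *m x) = 0 ->
  exists a, w = a *: l.
Proof.
move=> sw; rewrite mulmxA => /hyper_mul_eq0; rewrite mul_hyper sw mul0r scale0r.
by rewrite subr0 => /eqP; rewrite subr_eq0 => /eqP ->; exists (dot w l / dot l l).
Qed.

(** A combination of the columns of [x] that the projection kills is
    [m *: 1 + b *: l]; it is orthogonal to the dependency of [x], which forces
    [b = 0], and then the columns of [homogeneous x] would be dependent. *)
Lemma hyper_mul_full : row_full (hyper l *m x).
Proof.
have [[slam lamx] _] := lamP hn xE.
have : row_free (hyper l *m x)^T.
  rewrite -kermx_eq0; apply/rowV0P => v /sub_kermxP.
  rewrite trmx_mul tr_hyper mulmxA mul_hyper; set w := v *m x^T.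
  set m := _ / n.+2%:R; set b := _ / dot l l.
  move=> /eqP; rewrite subr_eq0 subr_eq => /eqP wE.
  have wlam : dot w (lam x) = 0.
    have /matrixP/(_ 0 0) : w *m (lam x)^T = 0.
      by rewrite -mulmxA -trmx_mul lamx trmx0 mulmx0.
    by rewrite mulmx_trE !mxE eqxx mulr1n.
  have b0 : b = 0.
    move: wlam; rewrite wE dotDl !dotZl (dotC one) dot_one slam mulr0 addr0.
    by move/eqP; rewrite mulf_eq0 (negbTE ll) orbF => /eqP.
  have freeh : row_free (homogeneous x)^T.
    by rewrite /row_free mxrank_tr; exact: homogeneous_full.
  have : row_mx (- m)%:M v *m (homogeneous x)^T = 0.
    rewrite /homogeneous tr_row_mx mul_row_col -/w wE b0 scale0r add0r.
    by rewrite trmx_const mul_scalar_mx scaleNr addNr.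
  move=> /eqP; rewrite (mulmx_free_eq0 _ freeh) => /eqP.
  by rewrite -[RHS](@row_mx0 _ 1 1 n) => /eq_row_mx[].
by rewrite /row_free mxrank_tr.
Qed.

End Projected.
End Hyper.

(** The Moore-Penrose inverse of a matrix with independent columns. *)
Definition pinv (y : 'M[R]_(n.+2, n)) : 'M[R]_(n, n.+2) := invmx (y^T *m y) *m y^T.

Lemma pinvK y : row_full y -> pinv y *m y = 1%:M.
Proof. by move=> fy; rewrite /pinv -mulmxA mulVmx// gram_unit. Qed.

Section ProjectedPinv.
Context {l} (sl : \sum_i l 0 i = 0) (l0 : l != 0).
Context {x} (xE : embedding_space R n x) (ll : dot l (lam x) != 0).
Let y := hyper l *m x.

Lemma one_y : one *m y = 0.
Proof. by rewrite mulmxA one_hyper// mul0mx. Qed.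

Lemma l_y : l *m y = 0.
Proof. by rewrite mulmxA l_hyper// mul0mx. Qed.

Lemma pinv_one : pinv y *m one^T = 0.
Proof. by rewrite -mulmxA -trmx_mul one_y trmx0 mulmx0. Qed.

Lemma pinv_l : pinv y *m l^T = 0.
Proof. by rewrite -mulmxA -trmx_mul l_y trmx0 mulmx0. Qed.

(** Both sides are projections with kernel spanned by [l] and the constants. *)
Lemma mul_pinv : y *m pinv y = hyper l.
Proof.
apply/eqP; rewrite -subr_eq0; apply/eqP/row_matrixP => i; rewrite row0.
have fy : row_full y by exact: hyper_mul_full.
set r := row i _.
have rE : r = row i (y *m pinv y) - row i (hyper l) by rewrite /r linearB.
have r1 : \sum_i r 0 i = 0.
  rewrite -dot_one rE dotBl; apply/eqP; rewrite subr_eq0; apply/eqP.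
  rewrite [in RHS]rowE dot_hyper_one//.
  have /matrixP/(_ 0 0) : row i (y *m pinv y) *m one^T = 0.
    by rewrite -row_mul -mulmxA pinv_one mulmx0 row0.
  by rewrite mulmx_trE !mxE eqxx mulr1n.
have rl : dot r l = 0.
  rewrite rE dotBl; apply/eqP; rewrite subr_eq0; apply/eqP.
  rewrite [in RHS]rowE dot_hyper_l//.
  have /matrixP/(_ 0 0) : row i (y *m pinv y) *m l^T = 0.
    by rewrite -row_mul -mulmxA pinv_l mulmx0 row0.
  by rewrite mulmx_trE !mxE eqxx mulr1n.
have ry : r *m y = 0.
  rewrite rE mulmxBl -!row_mul -mulmxA pinvK// mulmx1 [hyper l *m y]mulmxA.
  by rewrite hyper_id// subrr.
have [a ra] := hyper_ker sl l0 xE ll r1 ry.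
move: rl; rewrite ra dotZl => /eqP; rewrite mulf_eq0 dot_eq0 (negbTE l0) orbF.
by move/eqP ->; rewrite scale0r.
Qed.

End ProjectedPinv.

Section Shape.
Context {u : 'rV[R]_n.+2} {v a : 'I_n.+2} {s : R}.

(** For a dependency [u], row [i] of this oblique projection lists the barycentric
    coordinates of the vertex [i] with respect to the simplex spanned by the
    vertices other than [a]. *)
Definition barymx (a : 'I_n.+2) (u : 'rV[R]_n.+2) : 'M[R]_n.+2 :=
  1%:M - (u 0 a)^-1 *: ((delta_mx a 0 : 'cV[R]_n.+2) *m u).

(** For pyramidal weights [u], twice the Gram matrix of the pyramidal configuration
    with weights [u], up to terms that centring removes. The formula is symmetric
    in the vertices and continuous also where the two vertices off the base, or
    the apex and a vertex of the base, exchange their roles; [barymx], which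
    depends on the choice of [a], is not. *)
Definition shape (u : 'rV[R]_n.+2) : 'M[R]_n.+2 :=
  let q := ordstat n.+2 u in
  \matrix_(i, j) if i == j then 1 + n.+1%:R * Num.min (n%:R + 2 * u 0 i) 0 / q ^+ 2
                 else (1 - u 0 i) * (1 - u 0 j) / (q * (1 - q)).

Lemma mul_barymx (w : 'rV[R]_n.+2) :
  w *m barymx a u = w - (w 0 a / u 0 a) *: u.
Proof.
rewrite mulmxBr mulmx1 -scalemxAr mulmxA -colE; congr (_ - _).
rewrite (_ : col a w = (w 0 a)%:M) ?mul_scalar_mx ?scalerA 1?mulrC//.
by apply/matrixP => i j; rewrite !ord1 !mxE eqxx mulr1n.
Qed.

Hypothesis uw : pyramidal_weights u v a s.

Lemma weight_a_lt0 : u 0 a < 0.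
Proof.
have [_ s1 ->] := uw; rewrite eqxx oppr_lt0; have := @nR_gt2 R n hn; lra.
Qed.

Lemma barymx_tr : barymx a u *m (barymx a u)^T = 1%:M
  - (u 0 a)^-1 *: ((delta_mx a 0 : 'cV[R]_n.+2) *m u)
  - (u 0 a)^-1 *: (u^T *m (delta_mx 0 a : 'rV[R]_n.+2))
  + ((u 0 a)^-1 ^+ 2 * dot u u)
    *: ((delta_mx a 0 : 'cV[R]_n.+2) *m (delta_mx 0 a : 'rV[R]_n.+2)).
Proof.
have -> : (barymx a u)^T = 1%:M - (u 0 a)^-1 *: (u^T *m (delta_mx 0 a : 'rV[R]_n.+2)).
  by rewrite /barymx linearB /= trmx1 [X in _ - X]linearZ /= trmx_mul trmx_delta.
rewrite /barymx; set e := delta_mx a 0; set f := delta_mx 0 a.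
rewrite mulmxBl mul1mx mulmxBr mulmx1 -scalemxAl -!scalemxAr scalerA -expr2.
rewrite mulmxA -[e *m u *m u^T]mulmxA mulmx_trE mul_mx_scalar.
by rewrite -scalemxAl scalerA opprB addrA addrAC; congr (_ + _); exact: addrAC.
Qed.

(** The simplex on the vertices other than [a] has Gram matrix 1/2 up to centring,
    so the pyramidal configuration has half of [barymx *m barymx^T]. The last
    summand vanishes between vectors with coordinate sum zero. *)
Lemma shapeE : shape u = barymx a u *m (barymx a u)^T
  + (u 0 a)^-1 *: ((delta_mx a 0 : 'cV[R]_n.+2) *m one
                   + one^T *m (delta_mx 0 a : 'rV[R]_n.+2)).
Proof.
have [va s1 uE] := uw; have n2 := @nR_gt2 R n hn.
have qE : ordstat n.+2 u = - (n%:R + s).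
  by rewrite (ordstat_min (weights_min hn uw)) uE eqxx.
have q0 : n%:R + s != 0 by rewrite gt_eqF//; lra.
have q1 : 1 - - (n%:R + s) != 0 by rewrite gt_eqF//; lra.
have uu : dot u u = n%:R + s ^+ 2 + (n%:R + s) ^+ 2.
  transitivity (\sum_i (u 0 i) ^+ 2); first by apply: eq_bigr => i _; rewrite expr2.
  by rewrite (sum_weights (fun r => r ^+ 2) uw) expr1n sqrrN mulr1.
have dE (i j : 'I_n.+2) (w : 'rV[R]_n.+2) :
    (delta_mx a 0 *m w : 'M[R]_n.+2) i j = (i == a)%:R * w 0 j.
  by rewrite mxE big_ord1 mxE eqxx andbT.
have dE' (i j : 'I_n.+2) (w : 'rV[R]_n.+2) :
    (w^T *m delta_mx 0 a : 'M[R]_n.+2) i j = (j == a)%:R * w 0 i.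
  by rewrite mxE big_ord1 !mxE eqxx mulrC.
have addE (A B : 'M[R]_n.+2) i j : (A + B) i j = A i j + B i j by rewrite mxE.
have oppE (A : 'M[R]_n.+2) i j : (- A) i j = - A i j by rewrite mxE.
have scaleE k (A : 'M[R]_n.+2) i j : (k *: A) i j = k * A i j by rewrite mxE.
apply/matrixP => i j; rewrite barymx_tr.
rewrite !(addE, oppE, scaleE, dE, dE') uu !mxE qE !uE eqxx.
have [ia|ia] := eqVneq i a; have [ja|ja] := eqVneq j a.
- rewrite ia ja !eqxx /= min_l; last by lra.
  by rewrite mulr1n -natr1; field; rewrite q0.
- rewrite ia (eq_sym a j) (negbTE ja) /= mulr0n.
  by have [jv|jv] := eqVneq j v; field; rewrite ?q0 ?q1.
- rewrite ja (negbTE ia) /= mulr0n.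
  by have [iv|iv] := eqVneq i v; field; rewrite ?q0 ?q1.
- have [<-|ij] := eqVneq i j.
    rewrite min_r; last by case: eqP => _; lra.
    by rewrite mulr1n /= !mulr0n; field; rewrite ?q0.
  rewrite /= mulr0n; have [iv|iv] := eqVneq i v; have [jv|jv] := eqVneq j v.
  - by rewrite iv jv eqxx in ij.
  - by field; rewrite ?q0 ?q1.
  - by field; rewrite ?q0 ?q1.
  - by field; rewrite ?q0 ?q1.
Qed.

End Shape.

End Frames.

(** * The flow on labelled configurations *)

Section Flow.
Context {R : realType} {n : nat}.
Hypothesis hn : (2 < n)%N.
Implicit Types (x : 'M[R]_(n.+2, n)) (u l w : 'rV[R]_n.+2) (t : R).

Local Notation one := (const_mx 1 : 'rV[R]_n.+2).

Definition target x : 'rV[R]_n.+2 := cap (lam x).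

Definition projected x : 'M[R]_(n.+2, n) := hyper (target x) *m x.

(** The form Q for which y Q y^T is the Gram matrix of the pyramidal configuration
    with weights [target x], where y is [projected x]. *)
Definition gram_form x : 'M[R]_n :=
  2^-1 *: (pinv (projected x) *m shape (target x) *m (pinv (projected x))^T).

Definition frame x : 'M[R]_n := cholesky (gram_form x).

(** The barycenter moves to the origin, the dependency runs along [cap_path], and
    the frame given by the columns is straightened to the pyramidal one. *)
Definition flow t x : 'M[R]_(n.+2, n) :=
  (1 - t) *: (meanmx *m x)
  + hyper (cap_path t (lam x)) *m x *m ((1 - t)%:M + t *: frame x).

Section Embedded.
Context {x} (xE : embedding_space R n x).

Lemma lam_sum0 : \sum_i lam x 0 i = 0. Proof. by have [[]] := lamP hn xE. Qed.

Lemma lam_mul : lam x *m x = 0. Proof. by have [[]] := lamP hn xE. Qed.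

Lemma lam_ordstat : ordstat n (lam x) = 1. Proof. by have [] := lamP hn xE. Qed.

Lemma cap_path1 u : cap_path 1 u = cap u.
Proof. by rewrite /cap_path subrr scale0r add0r scale1r. Qed.

Lemma cap_path0 u : cap_path 0 u = u.
Proof. by rewrite /cap_path subr0 scale0r addr0 scale1r. Qed.

Lemma path_dot t : 0 <= t <= 1 -> 0 < dot (cap_path t (lam x)) (lam x).
Proof. by move=> t01; apply: cap_path_dot => //; exact: lam_ordstat. Qed.

Lemma path_sum0 t : \sum_i cap_path t (lam x) 0 i = 0.
Proof. by apply: cap_path_sum0 => //; [exact: lam_sum0 | exact: lam_ordstat]. Qed.

Lemma path_neq0 t : 0 <= t <= 1 -> cap_path t (lam x) != 0.
Proof.
move=> t01; apply/eqP => p0; have := path_dot t01.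
by rewrite p0 /dot big1 ?ltxx// => k _; rewrite mxE mul0r.
Qed.

Let t1 : 0 <= (1 : R) <= 1. Proof. by rewrite ler01 lexx. Qed.

Lemma target_dot : dot (target x) (lam x) != 0.
Proof. by rewrite /target -cap_path1 gt_eqF// path_dot. Qed.

Lemma target_sum0 : \sum_i target x 0 i = 0.
Proof. by rewrite /target -cap_path1 path_sum0. Qed.

Lemma target_neq0 : target x != 0.
Proof. by rewrite /target -cap_path1 path_neq0. Qed.

Lemma target_weights : exists v a s, pyramidal_weights (target x) v a s.
Proof. by apply: cap_weights => //; [exact: lam_sum0 | exact: lam_ordstat]. Qed.

Lemma projected_full : row_full (projected x).
Proof.
exact (hyper_mul_full hn xE target_dot).
Qed.

Section Weights.
Context {v a : 'I_n.+2} {s : R}.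
Hypothesis uw : pyramidal_weights (target x) v a s.

Let G := pinv (projected x) *m barymx a (target x).

Lemma gram_formE : gram_form x = 2^-1 *: (G *m G^T).
Proof.
rewrite /gram_form (shapeE hn uw) mulmxDr mulmxDl; congr (_ *: _).
rewrite [X in _ + X](_ : _ = 0) ?addr0.
  by rewrite /G [(_ *m barymx _ _)^T]trmx_mul !mulmxA.
have po : pinv (projected x) *m one^T = 0 by exact: (pinv_one target_sum0).
have po' : one *m (pinv (projected x))^T = 0 by rewrite -[one]trmxK -trmx_mul po trmx0.
rewrite -scalemxAr -scalemxAl mulmxDr mulmxDl (mulmxA (pinv _) one^T) po.
by rewrite !mul0mx addr0 -!mulmxA po' !mulmx0 scaler0.
Qed.

(** A vector killed by [barymx] is a multiple of the weights, while the rows of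
    [pinv] are orthogonal to them. *)
Lemma gram_posdef : posdef (gram_form x).
Proof.
rewrite gram_formE; split.
  by rewrite linearZ /= trmx_mul trmxK.
move=> v' v0; rewrite -scalemxAr -scalemxAl mulmx_gram.
rewrite !mxE eqxx mulr1n mulr_gt0 ?invr_gt0 ?ltr0n// dot_gt0.
apply: contra v0 => /eqP; rewrite /G mulmxA; set w := v' *m _.
have vE : w *m projected x = v' by rewrite -mulmxA pinvK ?mulmx1// projected_full.
rewrite mul_barymx => /eqP; rewrite subr_eq0 => /eqP wE.
have : dot w (target x) = 0.
  have /matrixP/(_ 0 0) : w *m (target x)^T = 0.
    by rewrite -mulmxA (pinv_l target_sum0 target_neq0) mulmx0.
  by rewrite mulmx_trE !mxE eqxx mulr1n.
rewrite wE dotZl => /eqP; rewrite mulf_eq0 dot_eq0 (negbTE target_neq0) orbF.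
by move=> /eqP k0; rewrite -vE wE k0 scale0r mul0mx.
Qed.

Lemma frame_gram : (projected x *m frame x) *m (projected x *m frame x)^T =
  2^-1 *: ((hyper (target x) *m barymx a (target x)) *m
           (hyper (target x) *m barymx a (target x))^T).
Proof.
rewrite trmx_mul mulmxA -[_ *m frame x *m _]mulmxA choleskyP; last exact: gram_posdef.
rewrite gram_formE -scalemxAr -scalemxAl; congr (_ *: _).
rewrite mulmxA -[_ *m _ *m (projected x)^T]mulmxA -trmx_mul.
by rewrite /G mulmxA /projected (mul_pinv hn target_sum0 target_neq0 xE target_dot).
Qed.

End Weights.

Lemma frame_unit t : 0 <= t <= 1 -> (1 - t)%:M + t *: frame x \in unitmx.
Proof.
move=> t01; apply: cholesky_segment_unit => //.
by have [v [a [s uw]]] := target_weights; exact: gram_posdef uw.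
Qed.

(** The projection is injective on the points, because the path stays on one side
    of the hyperplane orthogonal to [lam x], and the frame stays invertible. *)
Lemma flow_dependency t w : 0 <= t <= 1 -> dependency (flow t x) w ->
  exists a, w = a *: cap_path t (lam x).
Proof.
move=> t01 [sw]; rewrite /flow mulmxDr -scalemxAr !mulmxA mul_meanmx sw mul0r.
rewrite scale0r mul0mx scaler0 add0r => wf.
apply: (hyper_ker hn (path_sum0 t) (path_neq0 t01) xE _ sw).
  by rewrite gt_eqF// path_dot.
by rewrite mulmxA -[LHS](mulmxK (frame_unit t01)) wf mul0mx.
Qed.

Lemma path_flow t : 0 <= t <= 1 -> dependency (flow t x) (cap_path t (lam x)).
Proof.
move=> t01; split; first exact: path_sum0.
rewrite /flow mulmxDr -scalemxAr !mulmxA mul_meanmx path_sum0 mul0r scale0r.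
rewrite mul0mx scaler0 add0r l_hyper ?mul0mx//; [exact: path_sum0 | exact: path_neq0].
Qed.

Lemma flow_embedding t : 0 <= t <= 1 -> embedding_space R n (flow t x).
Proof.
move=> t01; apply/embedding_spaceP => // w /(flow_dependency t01)[a ->] w0.
have np := npos_cap_path hn lam_ordstat t01.
case: (ltgtP a 0) => [a0|a0|a0]; last by rewrite a0 scale0r eqxx in w0.
  by rewrite -scaleNr (@nposZ _ _ (- a)) ?oppr_gt0// np orbT.
by rewrite nposZ// np.
Qed.

Lemma flow0 : flow 0 x = x.
Proof.
rewrite /flow subr0 scale1r scale0r addr0 mulmx1 cap_path0 /hyper !mulmxBl mul1mx.
by rewrite -scalemxAl -mulmxA lam_mul mulmx0 scaler0 subr0 addrC subrK.
Qed.

Lemma mean_flow1 : one *m flow 1 x = 0.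
Proof.
rewrite /flow subrr scale0r add0r !mulmxA one_hyper ?mul0mx//.
exact: path_sum0.
Qed.

Lemma flow1 : flow 1 x = projected x *m frame x.
Proof. by rewrite /flow subrr scale0r raddf0 !add0r scale1r cap_path1. Qed.

(** ** Equivariance under relabelling *)

Section Relabel.
Variable s : 'S_n.+2.
Let p : 'M[R]_n.+2 := perm_mx s.

Lemma perm_mxV : p^T *m p = 1%:M.
Proof. by rewrite tr_perm_mx -perm_mxM mulVg perm_mx1. Qed.

Lemma col_perm_tr u : col_perm s u = u *m p^T.
Proof. by rewrite col_permE tr_perm_mx. Qed.

Lemma meanmx_perm : p *m meanmx = meanmx *m p.
Proof.
have -> : meanmx *m p = col_perm s^-1 meanmx by rewrite col_permE invgK.
by rewrite -row_permE; apply/matrixP => i j; rewrite !mxE.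
Qed.

Lemma hyper_perm l : hyper (col_perm s l) *m p = p *m hyper l.
Proof.
rewrite /hyper !mulmxBl !mulmxBr mul1mx mulmx1 meanmx_perm; congr (_ - _).
have -> : dot (col_perm s l) (col_perm s l) = dot l l.
  by rewrite /dot; under eq_bigr do rewrite mxE;
    rewrite [RHS](reindex_inj (@perm_inj _ s)).
rewrite -scalemxAl -scalemxAr; congr (_ *: _).
by rewrite col_perm_tr trmx_mul trmxK -!mulmxA perm_mxV mulmx1.
Qed.

Lemma shape_perm u : shape (col_perm s u) = p *m shape u *m p^T.
Proof.
rewrite -row_permE tr_perm_mx -col_permE; apply/matrixP => i j.
by rewrite !mxE ordstat_col_perm ?leqnn// (inj_eq perm_inj).
Qed.

Lemma pinv_perm (y : 'M[R]_(n.+2, n)) : pinv (p *m y) = pinv y *m p^T.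
Proof.
by rewrite /pinv trmx_mul -!mulmxA (mulmxA p^T) perm_mxV mul1mx.
Qed.

Lemma flow_perm t : flow t (row_perm s x) = row_perm s (flow t x).
Proof.
have lamE : lam (row_perm s x) = col_perm s (lam x) by exact: lam_perm.
have pathE : cap_path t (col_perm s (lam x)) = col_perm s (cap_path t (lam x)).
  by rewrite /cap_path cap_col_perm col_permE -!scalemxAl -?scalemxAl !col_permE
    mulmxDl -!scalemxAl.
have targetE : target (row_perm s x) = col_perm s (target x).
  by rewrite /target lamE cap_col_perm.
have projE : projected (row_perm s x) = p *m projected x.
  by rewrite /projected targetE row_permE mulmxA hyper_perm mulmxA.
have frameE : frame (row_perm s x) = frame x.
  rewrite /frame /gram_form projE targetE shape_perm pinv_perm; congr (cholesky (_ *: _)).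
  rewrite trmx_mul trmxK -!mulmxA (mulmxA p^T p) perm_mxV mul1mx.
  by rewrite (mulmxA p^T p) perm_mxV mul1mx.
rewrite /flow frameE lamE pathE !row_permE [RHS]mulmxDr -/p; congr (_ + _).
  by rewrite -scalemxAr !mulmxA meanmx_perm.
by rewrite !mulmxA hyper_perm.
Qed.

End Relabel.

(** ** Continuity of the flow *)

Lemma cvg_hyper (T : Type) (F : set_system T) (FF : Filter F)
    (f : T -> 'rV[R]_n.+2) l : l != 0 ->
  f @ F --> l -> hyper (f y) @[y --> F] --> hyper l.
Proof.
move=> l0 fl; apply: cvgB; first exact: cvg_cst.
apply: cvgZ; last by apply: cvg_mulmx => //; exact: cvg_trmx.
apply: cvgV; first by rewrite dot_eq0.
by apply: cvg_sumr => k _; apply: cvgM; exact: cvg_coord.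
Qed.

Lemma cvg_shape (T : Type) (F : set_system T) (FF : Filter F)
    (f : T -> 'rV[R]_n.+2) u : ordstat n.+2 u < 0 ->
  f @ F --> u -> shape (f y) @[y --> F] --> shape u.
Proof.
move=> q0 fu; have fi i : f y 0 i @[y --> F] --> u 0 i by exact: cvg_coord.
have cq : ordstat n.+2 (f y) @[y --> F] --> ordstat n.+2 u.
  by apply: cvg_ordstat => //; rewrite leqnn.
apply: cvg_mx => i j; rewrite mxE; under eq_cvg do rewrite mxE.
have cc (k : R) : (fun=> k) @ F --> k by exact: cvg_cst.
case: (i == j).
  apply: cvgD => //; apply: cvgM.
    by apply: cvgM => //; apply: cvg_minr => //; apply: cvgD => //; exact: cvgM.
  apply: cvgV; first by rewrite sqrf_eq0 lt_eqF.
  by under eq_cvg do rewrite expr2; rewrite expr2; exact: cvgM.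
apply: cvgM; first by apply: cvgM; exact: cvgB.
apply: cvgV; last by apply: cvgM => //; exact: cvgB.
by rewrite mulf_neq0 ?(lt_eqF q0)// subr_eq0 gt_eqF// (lt_trans q0).
Qed.

Lemma cvg_flow (T : Type) (F : set_system T) (FF : Filter F)
    (f : T -> 'M[R]_(n.+2, n)) (g : T -> R) t : 0 <= t <= 1 ->
  f @ F --> x -> g @ F --> t -> flow (g y) (f y) @[y --> F] --> flow t x.
Proof.
move=> t01 fx gt.
have clam : lam (f y) @[y --> F] --> lam x by exact: cvg_lam.
have ctar : target (f y) @[y --> F] --> target x.
  by apply: cvg_cap => //; exact: lam_ordstat.
have c1g : 1 - g y @[y --> F] --> 1 - t by apply: cvgB => //; exact: cvg_cst.
have cpath : cap_path (g y) (lam (f y)) @[y --> F] --> cap_path t (lam x).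
  by apply: cvgD; exact: cvgZ.
have cproj : projected (f y) @[y --> F] --> projected x.
  by apply: cvg_mulmx => //; apply: cvg_hyper => //; exact: target_neq0.
have cpinv : pinv (projected (f y)) @[y --> F] --> pinv (projected x).
  apply: cvg_mulmx; last exact: cvg_trmx.
  apply: cvg_invmx; first exact/gram_unit/projected_full.
  by apply: cvg_mulmx => //; exact: cvg_trmx.
have [v [a [s uw]]] := target_weights.
have cgram : gram_form (f y) @[y --> F] --> gram_form x.
  apply: cvgZ; first exact: cvg_cst.
  apply: cvg_mulmx; last exact: cvg_trmx.
  apply: cvg_mulmx => //; apply: cvg_shape => //.
  by rewrite (ordstat_min (weights_min hn uw)); exact: weight_a_lt0 uw.
have cframe : frame (f y) @[y --> F] --> frame x.
  by apply: cvg_cholesky => //; exact: gram_posdef uw.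
apply: cvgD.
  by apply: cvgZ => //; apply: cvg_mulmx => //; exact: cvg_cst.
apply: cvg_mulmx.
  by apply: cvg_mulmx => //; apply: cvg_hyper => //; exact: path_neq0.
apply: cvgD; last exact: cvgZ.
apply: cvg_mx => i j; rewrite mxE; under eq_cvg do rewrite mxE.
by case: (i == j); [exact: c1g | exact: cvg_cst].
Qed.

End Embedded.
End Flow.

(** * Pyramidal configurations *)

Section PyramidalConfigurations.
Context {R : realType} {n : nat}.
Hypothesis hn : (2 < n)%N.
Implicit Types (x : 'M[R]_(n.+2, n)) (u w : 'rV[R]_n.+2) (v a : 'I_n.+2) (t s : R).

Local Notation one := (const_mx 1 : 'rV[R]_n.+2).
Local Notation nR := (n%:R : R).
Local Notation base v a := (~: [set v; a])%SET.

Lemma eucl_dist1 m (p q : 'rV[R]_m) : eucl_dist p q = 1 <-> dot (p - q) (p - q) = 1.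
Proof.
split=> [e1|d1]; last by rewrite /eucl_dist d1 sqrtr1.
by rewrite -[LHS]sqr_sqrtr ?dot_ge0// -/(eucl_dist p q) e1 expr1n.
Qed.

Lemma dot_polar m (p q r z : 'rV[R]_m) : dot (p - q) (r - z) =
  2^-1 * (dot (p - z) (p - z) + dot (q - r) (q - r)
          - dot (p - r) (p - r) - dot (q - z) (q - z)).
Proof.
rewrite !dotBl !dotBr (dotC z p) (dotC r q) (dotC r p) (dotC z q).
set c := dot p z; set d := dot q r; set e := dot p r; set f := dot q z; by field.
Qed.

Lemma dot_suml m (I : finType) (P : pred I) (f : I -> 'rV[R]_m) q :
  dot (\sum_(i | P i) f i) q = \sum_(i | P i) dot (f i) q.
Proof.
rewrite /dot exchange_big/=; apply: eq_bigr => k _.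
by rewrite summxE mulr_suml.
Qed.

Lemma dot_delta m (p : 'rV[R]_m) i : dot p (delta_mx 0 i) = p 0 i.
Proof.
rewrite /dot (bigD1 i)//= mxE !eqxx mulr1 big1 ?addr0// => k /negbTE ki.
by rewrite mxE ki andbF mulr0.
Qed.

Lemma sum_vertices (V : zmodType) v a (f : 'I_n.+2 -> V) : v != a ->
  \sum_i f i = f a + (f v + \sum_(i in base v a) f i).
Proof.
move=> va; rewrite (bigD1 a)//= (bigD1 v)//=; congr (_ + (_ + _)).
by apply: eq_bigl => i; rewrite !inE negb_or andbC.
Qed.

Lemma card_base v a : v != a -> #|base v a|%SET = n.
Proof. by move=> va; rewrite cardsCs finset.setCK card_ord cards2 va subn2. Qed.

Lemma simplexE v a : v != a -> (v |: base v a = ~: [set a])%SET.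
Proof.
move=> va; apply/setP => i; rewrite !inE negb_or.
by case: eqP => [->|]; rewrite ?va//= orbF.
Qed.

Lemma nR_neq0 : nR != 0.
Proof. by rewrite pnatr_eq0 -lt0n (ltn_trans _ hn). Qed.

Section Apex.
Context {x} {v a : 'I_n.+2} (va : v != a).
Let b := barycenter x (base v a).
Let d := row v x - b.

Lemma base_sum : \sum_(k in base v a) row k x = nR *: b.
Proof. by rewrite /b /barycenter card_base// scalerA divff ?scale1r// nR_neq0. Qed.

Lemma weighted_sum u (mu : R) : (forall k, k \in base v a -> u 0 k = mu) ->
  u *m x = u 0 a *: (row a x) + (u 0 v *: row v x + mu * nR *: b).
Proof.
move=> umu; rewrite mulmx_sum_row (sum_vertices _ va); congr (_ + (_ + _)).
rewrite -scalerA -base_sum scaler_sumr; apply: eq_bigr => k kF.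
by rewrite umu.
Qed.

Lemma weight_sum u (mu : R) : (forall k, k \in base v a -> u 0 k = mu) ->
  \sum_i u 0 i = u 0 a + (u 0 v + mu * nR).
Proof.
move=> umu; rewrite (sum_vertices _ va); congr (_ + (_ + _)).
by rewrite (eq_bigr (fun=> mu))// sumr_const card_base// mulr_natr.
Qed.

(** Solving the dependency for the last vertex: [s / (n + s)] is its signed height,
    in units of the height of the apex. *)
Lemma weights_line u s : pyramidal_weights u v a s -> u *m x = 0 ->
  row a x - b = (s / (nR + s)) *: d.
Proof.
move=> [_ s1 uE]; rewrite (@weighted_sum u 1); last first.
  by move=> k; rewrite !inE negb_or uE => /andP[/negbTE -> /negbTE ->].
have n2 := @nR_gt2 R n hn; have ns : nR + s != 0 by rewrite gt_eqF//; lra.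
rewrite !uE !eqxx (negbTE va) mul1r /d.
move: (row a x) (row v x) (b) => pa pv c /rowP ux; apply/rowP => k.
have {ux} := ux k; rewrite !mxE => e; apply: (mulfI ns).
by rewrite [RHS]mulrA [_ * (s / _)]mulrC divfK//; lra.
Qed.

Section Regular.
Hypothesis reg : unit_regular x (~: [set a])%SET.

Lemma regular_dist i j : i != a -> j != a ->
  dot (row i x - row j x) (row i x - row j x) = (i != j)%:R.
Proof.
move=> ia ja; have [->|ij] := eqVneq i j.
  by rewrite subrr /dot big1// => k _; rewrite mxE mul0r.
by apply/eucl_dist1/reg; rewrite ?inE.
Qed.

Lemma regular_dot i m k l : i != a -> m != a -> k != a -> l != a ->
  dot (row i x - row m x) (row k x - row l x) =
  2^-1 * ((i == k)%:R - (i == l)%:R - (m == k)%:R + (m == l)%:R).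
Proof.
move=> ia ma ka la; rewrite dot_polar !regular_dist//.
by do 4! case: eqP => _ /=; field.
Qed.

Lemma baseP k : k \in base v a -> (k != v) /\ (k != a).
Proof. by rewrite !inE negb_or => /andP[]. Qed.

Lemma dot_bary (p q : 'rV[R]_n) :
  dot (p - b) q = nR^-1 * \sum_(m in base v a) dot (p - row m x) q.
Proof.
rewrite -dot_suml sumrB sumr_const card_base// base_sum -(scaler_nat n p) -scalerBr.
by rewrite dotZl mulKf// nR_neq0.
Qed.

Lemma sum_base_eq k : k \in base v a -> \sum_(m in base v a) (m == k)%:R = 1 :> R.
Proof.
move=> kF; rewrite (bigD1 k)//= eqxx big1 ?addr0// => m /andP[_ /negbTE mk].
by rewrite mk.
Qed.

Lemma apex_perp k l : k \in base v a -> l \in base v a ->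
  dot d (row k x - row l x) = 0.
Proof.
move=> kF lF; have [kv ka] := baseP kF; have [lv la] := baseP lF.
rewrite dot_bary (eq_bigr (fun m => 2^-1 * ((m == l)%:R - (m == k)%:R))).
  by rewrite -mulr_sumr sumrB !sum_base_eq// subrr !mulr0.
move=> m /baseP[mv ma]; rewrite regular_dot//.
by rewrite eq_sym (negbTE kv) eq_sym (negbTE lv); ring.
Qed.

Lemma base_perp i k l : i \in base v a -> k \in base v a -> l \in base v a ->
  dot (row i x - b) (row k x - row l x) = 2^-1 * ((i == k)%:R - (i == l)%:R).
Proof.
move=> iF kF lF; have [_ ia] := baseP iF.
have [_ ka] := baseP kF; have [_ la] := baseP lF.
rewrite dot_bary (eq_bigr (fun m => 2^-1 * ((i == k)%:R - (i == l)%:R)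
    + 2^-1 * ((m == l)%:R - (m == k)%:R))).
  rewrite big_split/= -[X in _ + X]mulr_sumr sumrB !sum_base_eq// subrr mulr0 addr0.
  by rewrite sumr_const card_base// -[(_ * _) *+ n]mulr_natl mulKf// nR_neq0.
by move=> m /baseP[mv ma]; rewrite regular_dot//; ring.
Qed.

Lemma base_nonempty : exists k, k \in base v a.
Proof.
by apply/set0Pn; rewrite -card_gt0 card_base// (ltn_trans _ hn).
Qed.

Lemma apex_neq0 : d != 0.
Proof.
have [k kF] := base_nonempty; have [kv ka] := baseP kF.
apply/eqP => d0; have : dot d (row v x - row k x) = 0.
  by rewrite d0 /dot big1// => j _; rewrite mxE mul0r.
rewrite dot_bary (eq_bigr (fun m => 2^-1 + 2^-1 * (m == k)%:R)); last first.
  move=> m /baseP[mv ma]; rewrite regular_dot// eqxx (negbTE mv) eq_sym (negbTE kv).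
  by rewrite /=; ring.
rewrite big_split/= -mulr_sumr sum_base_eq// sumr_const card_base// -[2^-1 *+ n]mulr_natl.
move=> /eqP; rewrite mulf_eq0 invr_eq0 (negbTE nR_neq0)/= => /eqP.
by have := @nR_gt2 R n hn; lra.
Qed.

Lemma dot_base_bary (w0 : 'rV[R]_n) i : i \in base v a ->
  (forall k l, k \in base v a -> l \in base v a -> dot w0 (row k x - row l x) = 0) ->
  dot w0 (row i x - b) = 0.
Proof.
move=> iF w0F; rewrite dotC dot_bary big1 ?mulr0// => m mF.
by rewrite dotC w0F.
Qed.

Lemma full_bary : barycenter x (~: [set a])%SET - b = n.+1%:R^-1 *: d.
Proof.
rewrite /barycenter -(simplexE va) cardsU1 card_base// big_setU1; last first.
  by rewrite !inE eqxx.
rewrite base_sum !inE eqxx /= add1n /d.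
have n1 : nR + 1 != 0 by rewrite natr1 pnatr_eq0.
by move: (row v x) (b) => p c; apply/rowP => k; rewrite !mxE -natr1; field.
Qed.

End Regular.
End Apex.

Definition pyramid x v a s u : Prop :=
  [/\ pyramidal_weights u v a s, unit_regular x (~: [set a])%SET,
      dependency x u & one *m x = 0].

Lemma barycenter_all x : barycenter x [set: 'I_n.+2]%SET = 0 <-> one *m x = 0.
Proof.
have -> : one *m x = \sum_(k in [set: 'I_n.+2]%SET) row k x.
  rewrite mulmx_sum_row; apply: eq_big => [k|k _]; first by rewrite !inE.
  by rewrite mxE scale1r.
rewrite /barycenter; split=> [/eqP|->]; last by rewrite scaler0.
by rewrite scaler_eq0 invr_eq0 cardsT card_ord pnatr_eq0 => /eqP.
Qed.

(** Seen from the barycenter of the base, the apex and the last vertex are both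
    perpendicular to the edges of the base, so pairing the dependency with these
    edges shows that its weights are constant on the base. Then the dependency
    relates only these three points. *)
Lemma apex_line x v a : embedding_space R n x -> v != a ->
  unit_regular x (~: [set a])%SET ->
  on_perp_through_barycenter x (base v a) (row a x) ->
  exists t, row a x - barycenter x (base v a) =
            t *: (row v x - barycenter x (base v a)).
Proof.
move=> xE va reg perp; set b := barycenter _ _; set d := row v x - b.
have [[sl lx] cl] := lamP hn xE; have l0 := ordstat1_neq0 hn cl.
have d0 : d != 0 by exact: apex_neq0.
have lconst k j : k \in base v a -> j \in base v a -> lam x 0 k = lam x 0 j.
  move=> kF jF; set e := row k x - row j x.
  have : \sum_i lam x 0 i * dot (row i x - b) e = 0.
    transitivity (dot (lam x *m x - (\sum_i lam x 0 i) *: b) e).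
      rewrite mulmx_sum_row scaler_suml -sumrB dot_suml; apply: eq_bigr => i _.
      by rewrite -scalerBr dotZl.
    by rewrite lx sl scale0r subrr /dot big1// => m _; rewrite mxE mul0r.
  rewrite (sum_vertices _ va) perp// (apex_perp va reg)// !mulr0 !add0r.
  rewrite (eq_bigr (fun i => 2^-1 * (lam x 0 i * (i == k)%:R)
                           - 2^-1 * (lam x 0 i * (i == j)%:R))); last first.
    by move=> i iF; rewrite (base_perp va reg)//; ring.
  have pick i : i \in base v a ->
      \sum_(m in base v a) lam x 0 m * (m == i)%:R = lam x 0 i.
    move=> iF; rewrite (bigD1 i)//= eqxx mulr1 big1 ?addr0//.
    by move=> m /andP[_ /negbTE ->]; rewrite mulr0.
  rewrite sumrB -!mulr_sumr !pick// -mulrBr => /eqP.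
  by rewrite mulf_eq0 invr_eq0 pnatr_eq0/= subr_eq0 => /eqP.
have [k0 k0F] := @base_nonempty v a va.
have lmu k : k \in base v a -> lam x 0 k = lam x 0 k0 by move=> kF; exact: lconst.
have := weight_sum va lmu; rewrite sl => s0.
have lineE : lam x 0 a *: (row a x - b) + lam x 0 v *: d = 0.
  have := weighted_sum (x := x) va lmu; rewrite lx -/b => /esym e0.
  have e1 : lam x 0 k0 * nR = - (lam x 0 a + lam x 0 v).
    by apply/eqP; rewrite -addr_eq0 addrC -addrA -s0.
  rewrite -[RHS]e0 e1 /d.
  move: (lam x 0 a) (lam x 0 v) (row a x) (row v x) (b) => la lv pa pv c.
  by apply/rowP => j; rewrite !mxE; ring.
have la0 : lam x 0 a != 0.
  apply: contra l0 => /eqP la; move: lineE; rewrite la scale0r add0r => /eqP.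
  rewrite scaler_eq0 (negbTE d0) orbF => /eqP lv.
  have lk : lam x 0 k0 = 0.
    move: s0; rewrite la lv !add0r => /esym/eqP.
    by rewrite mulf_eq0 (negbTE nR_neq0) orbF => /eqP.
  apply/eqP/rowP => i; rewrite [RHS]mxE.
  have [->//|ia] := eqVneq i a; have [->//|iv] := eqVneq i v.
  by rewrite lmu// !inE negb_or iv ia.
exists (- (lam x 0 v / lam x 0 a)); apply: (scalerI la0).
move/eqP: lineE; rewrite addr_eq0 => /eqP ->.
by rewrite scalerA mulrN mulrCA divff// mulr1 scaleNr.
Qed.

(** If [t] is the signed height of the last vertex in units of the height of the
    apex, the conditions on its position say that [-1 <= t <= 1 / (n + 1)], and
    [s = t n / (1 - t)] is the weight that puts it there. *)
Lemma pyramidal_pyramid x : embedding_space R n x -> pyramidal x ->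
  exists v a s u, pyramid x v a s u.
Proof.
move=> xE [v [a [va]]]; cbv zeta; rewrite simplexE//.
move=> [[_ reg] perp /andP[_ hle] [hin hout] /barycenter_all bary0].
have [t pa] := apex_line xE va reg perp.
set b := barycenter x (base v a) in pa hle hin hout.
set d := row v x - b in pa.
have d0 : d != 0 by exact: apex_neq0.
have dd0 : 0 < dot d d by rewrite dot_gt0.
have n2 := @nR_gt2 R n hn.
have tN1 : -1 <= t.
  move: hle; rewrite /eucl_dist -/d pa dotZl dotC dotZl mulrA -expr2.
  rewrite ler_sqrt ?dot_ge0// ger_pMl// => t2; nra.
have tn : t <= n.+1%:R^-1.
  have [ins|outs] := pselect (span_simplex x (~: [set a])%SET (row a x)).
    have [tau + pE] := hin ins; rewrite /= in_itv/= => /andP[tau0 tau1].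
    have : t *: d = ((1 - tau) * n.+1%:R^-1) *: d.
      rewrite -pa -pE -scalerA -(full_bary va) -/b.
      move: (barycenter _ _) (b) => p c.
      by apply/rowP => j; rewrite !mxE; ring.
    move/eqP; rewrite -subr_eq0 -scalerBl scaler_eq0 (negbTE d0) orbF subr_eq0.
    move=> /eqP ->; rewrite ler_piMl ?invr_ge0 ?ler0n//; lra.
  have [w0 [c [w0F /andP[wa wv]]]] := hout outs.
  have [k0 k0F] := @base_nonempty v a va.
  have w0b : dot w0 b = c.
    have : dot w0 (row k0 x - b) = 0.
      by apply: dot_base_bary => // k l kF lF; rewrite dotBr !w0F// subrr.
    by rewrite dotBr w0F// => /eqP; rewrite subr_eq0 => /eqP.
  have wd : 0 < dot w0 d by rewrite dotBr w0b subr_gt0.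
  have : t * dot w0 d < 0.
    have <- : dot w0 (row a x - b) = t * dot w0 d by rewrite pa dotC dotZl dotC.
    by rewrite dotBr w0b subr_lt0.
  rewrite pmulr_llt0// => t0; apply: ltW; apply: lt_le_trans t0 _.
  by rewrite invr_ge0 ler0n.
have tn' : t * (nR + 1) <= 1.
  by rewrite natr1 -ler_pdivlMr ?ltr0n// mul1r.
have t1 : 0 < 1 - t by nra.
pose s := t * nR / (1 - t).
have nsE : nR + s = nR / (1 - t) by rewrite /s; field; rewrite gt_eqF.
pose u : 'rV[R]_n.+2 :=
  \row_i if i == a then - (nR + s) else if i == v then s else 1.
have uw : pyramidal_weights u v a s.
  split=> //; last by move=> i; rewrite mxE.
  apply/andP; split; last by rewrite /s ler_pdivrMr// mul1r; lra.
  rewrite /s ler_pdivlMr//; nra.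
exists v, a, s, u; split=> //; split; first exact: weights_sum0 uw.
rewrite (@weighted_sum _ _ _ va u 1); last first.
  by move=> k; rewrite !inE negb_or !mxE => /andP[/negbTE -> /negbTE ->].
have -> : u 0 a = - (nR + s) by rewrite mxE eqxx.
have -> : u 0 v = s by rewrite mxE (negbTE va) eqxx.
have -> : row a x = b + t *: d by rewrite -pa addrC subrK.
rewrite mul1r -/b nsE /d; move: (row v x) (b) => p c.
by apply/rowP => j; rewrite !mxE /s; field; rewrite gt_eqF.
Qed.

(** Pairing with the altitude [d] separates the two cases: the simplex lies in the
    half space where [d] is at least its value on the base. *)
Lemma pyramid_pyramidal x v a s u : pyramid x v a s u -> pyramidal x.
Proof.
move=> [uw reg [su ux] one0]; have [va s1 uE] := uw.
have n2 := @nR_gt2 R n hn.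
exists v, a; split=> //; cbv zeta; rewrite simplexE//.
have pa := weights_line va uw ux.
set b := barycenter x (base v a) in pa *; set d := row v x - b in pa.
have d0 : d != 0 by exact: apex_neq0.
have dd0 : 0 < dot d d by rewrite dot_gt0.
have ns : 0 < nR + s by lra.
pose t := s / (nR + s).
have tN1 : -1 <= t by rewrite /t ler_pdivlMr//; lra.
have tn : t * (nR + 1) <= 1 by rewrite /t mulrAC ler_pdivrMr//; nra.
have {}pa : row a x - b = t *: d by [].
have paE : row a x = b + t *: d by rewrite -pa addrC subrK.
have dF k : k \in base v a -> dot d (row k x - b) = 0.
  by move=> kF; apply: dot_base_bary => // *; exact: apex_perp.
split.
- split=> // k l kF lF; apply: reg; rewrite !inE.
    by have [] := baseP kF.
  by have [] := baseP lF.
- by move=> k l kF lF; rewrite pa dotZl (apex_perp va reg)// mulr0.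
- rewrite sqrtr_ge0/= /eucl_dist pa -/d ler_sqrt ?dot_ge0//.
  rewrite dotZl dotC dotZl mulrA ger_pMl//; nra.
- split=> [[w [w0 wa w1] wx]|nspan].
    have t0 : 0 <= t.
      have : 0 <= dot (row a x - b) d.
        have -> : row a x - b = \sum_i w 0 i *: (row i x - b).
          rewrite (eq_bigr (fun i => w 0 i *: row i x - w 0 i *: b)).
            by rewrite sumrB -mulmx_sum_row -scaler_suml w1 scale1r wx.
          by move=> i _; rewrite scalerBr.
        rewrite (sum_vertices _ va) wa ?inE ?eqxx// scale0r add0r dotDl dotZl.
        have -> : dot (\sum_(i in base v a) w 0 i *: (row i x - b)) d = 0.
          by rewrite dot_suml big1// => k kF; rewrite dotZl dotC dF// mulr0.
        by rewrite addr0 mulr_ge0// dot_ge0.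
      by rewrite pa dotZl pmulr_lge0.
    exists (1 - n.+1%:R * t).
      rewrite /= in_itv/= subr_ge0 gerBl mulr_ge0 ?ler0n// andbT.
      by rewrite -natr1 mulrC.
    have -> : barycenter x (~: [set a])%SET = b + n.+1%:R^-1 *: d.
      by rewrite -(full_bary va) addrC subrK.
    have n1 : nR + 1 != 0 by rewrite natr1 pnatr_eq0.
    rewrite paE -natr1; move: (d) (b) (t) => d' c t'.
    by apply/rowP => k; rewrite !mxE; field.
  have t0 : t < 0.
    rewrite ltNge; apply/negP => t0; apply: nspan.
    exists (\row_i if i == a then 0 else if i == v then t else (1 - t) / nR).
      split=> [i|i|].
      - rewrite mxE; case: eqP => // _; case: eqP => // _.
        by rewrite divr_ge0//; nra.
      - by rewrite !inE negbK mxE => ->.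
      - rewrite (@weight_sum v a va _ ((1 - t) / nR)).
          by rewrite !mxE !eqxx (negbTE va) divfK ?nR_neq0// add0r addrC subrK.
        by move=> k; rewrite !inE negb_or !mxE => /andP[/negbTE -> /negbTE ->].
    rewrite (@weighted_sum _ _ _ va _ ((1 - t) / nR)); last first.
      by move=> k; rewrite !inE negb_or !mxE => /andP[/negbTE -> /negbTE ->].
    rewrite !mxE !eqxx (negbTE va) divfK ?nR_neq0// scale0r add0r -/b paE /d.
    move: (row v x) (b) (t) => p c t'.
    by apply/rowP => k; rewrite !mxE; ring.
  exists d, (dot d b); split=> [k kF|].
    by apply/eqP; rewrite -subr_eq0 -dotBr dF.
  rewrite paE dotC dotDl dotZl (dotC b) gtrDl pmulr_llt0// t0/=.
  by rewrite -subr_gt0 -dotBr.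
- exact/barycenter_all.
Qed.

(** ** The flow fixes pyramidal configurations *)

(** Since [barymx] fixes [x] and its column [a] is zero, only the scalar products
    between the vertices other than [a] matter. Up to terms that centring removes
    they are minus half the squared distances, which are all equal to 1. *)
Lemma pyramid_gram x v a s u : pyramid x v a s u ->
  exists w, x *m x^T = one^T *m w + w^T *m one
    + 2^-1 *: (barymx a u *m (barymx a u)^T - one^T *m one).
Proof.
move=> [uw reg [su ux] one0].
pose nu : 'rV[R]_n.+2 := \row_i (dot (row i x) (row i x) / 2).
pose K := x *m x^T - (one^T *m nu + nu^T *m one + 2^-1 *: (1%:M - one^T *m one)).
set B := barymx a u.
have a0 : u 0 a != 0 by rewrite lt_eqF// (weight_a_lt0 hn uw).
have Bx : B *m x = x.
  by rewrite mulmxBl mul1mx -scalemxAl -mulmxA ux mulmx0 scaler0 subr0.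
have Bone : B *m one^T = one^T.
  rewrite mulmxBl mul1mx -scalemxAl -mulmxA mulmx_trE dot_one su raddf0.
  by rewrite mulmx0 scaler0 subr0.
have Ba i : B i a = 0.
  rewrite !mxE big_ord1 !mxE eqxx andbT; case: eqP => _ /=.
    by rewrite mul1r mulVf// subrr.
  by rewrite mul0r mulr0 subr0.
clearbody B; have K0 k l : k != a -> l != a -> K k l = 0.
  move=> ka la; have := regular_dist reg ka la; rewrite !dotBl !dotBr => reg'.
  have xx : (x *m x^T) k l = dot (row k x) (row l x).
    by rewrite mxE; apply: eq_bigr => m _; rewrite !mxE.
  have oE (w : 'rV[R]_n.+2) : (one^T *m w : 'M[R]_n.+2) k l = w 0 l.
    by rewrite mxE big_ord1 !mxE mul1r.
  have oE' (w : 'rV[R]_n.+2) : (w^T *m one : 'M[R]_n.+2) k l = w 0 k.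
    by rewrite mxE big_ord1 !mxE mulr1.
  have addE (A C : 'M[R]_n.+2) i j : (A + C) i j = A i j + C i j by rewrite mxE.
  have oppE (A : 'M[R]_n.+2) i j : (- A) i j = - A i j by rewrite mxE.
  have scaleE c (A : 'M[R]_n.+2) i j : (c *: A) i j = c * A i j by rewrite mxE.
  rewrite /K !(addE, oppE, scaleE) xx !oE oE' !mxE.
  move: reg'; rewrite (dotC (row l x) (row k x)).
  by case: eqP => _ /=; rewrite ?mulr1n ?mulr0n => ?; lra.
have BKB : B *m K *m B^T = 0.
  apply/matrixP => i j; rewrite mxE big1 ?mxE// => l _; rewrite [B^T _ _]mxE.
  have [->|la] := eqVneq l a; first by rewrite Ba mulr0.
  rewrite mxE big1 ?mul0r// => k _; have [->|ka] := eqVneq k a.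
    by rewrite Ba mul0r.
  by rewrite K0// mulr0.
exists (nu *m B^T).
have xxE : x *m x^T = B *m (x *m x^T) *m B^T.
  by rewrite mulmxA Bx -mulmxA -trmx_mul Bx.
rewrite [LHS]xxE; have -> : x *m x^T = K +
    (one^T *m nu + nu^T *m one + 2^-1 *: (1%:M - one^T *m one)).
  by rewrite /K subrK.
rewrite mulmxDr mulmxDl BKB add0r.
have Bone' : one *m B^T = one by rewrite -[one]trmxK -trmx_mul Bone.
rewrite !mulmxDr !mulmxDl -scalemxAr -scalemxAl mulmxBr mulmxBl mulmx1.
congr (_ + _ + _ *: (_ - _)).
- by rewrite mulmxA Bone -mulmxA.
- by rewrite trmx_mul trmxK -!mulmxA Bone'.
- by rewrite mulmxA Bone -mulmxA Bone'.
Qed.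

(** A pyramidal configuration has the Gram matrix that the flow aims at, so the
    form is the identity and with it its Cholesky factor. *)
Lemma flow_pyramid x v a s u t : embedding_space R n x -> pyramid x v a s u ->
  flow t x = x.
Proof.
move=> xE pyr; have [uw reg du one0] := pyr; have [su ux] := du.
have cu := weights_ordstat1 hn uw.
have lamE : lam x = u by exact: lam_unique.
have capE : cap u = u by apply: cap_id => //; exact: weights_le1 hn _ _ _ _ uw.
have pathE : cap_path t u = u by rewrite /cap_path capE -scalerDl subrK scale1r.
have mean0 : meanmx *m x = 0.
  apply/row_matrixP => i; rewrite row_mul row0.
  have -> : row i meanmx = n.+2%:R^-1 *: one by apply/rowP => j; rewrite !mxE mulr1.
  by rewrite -scalemxAl one0 scaler0.
have hyperE : hyper u *m x = x.
  by rewrite !mulmxBl mul1mx mean0 subr0 -scalemxAl -mulmxA ux mulmx0 scaler0 subr0.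
have projE : projected x = x by rewrite /projected /target lamE capE.
have uw' : pyramidal_weights (target x) v a s by rewrite /target lamE capE.
have gramE : gram_form x = 1%:M.
  rewrite (gram_formE hn xE uw') projE /target lamE capE.
  have fx : row_full x by rewrite -projE; exact: projected_full.
  have po : pinv x *m one^T = 0.
    by rewrite -mulmxA -trmx_mul one0 trmx0 mulmx0.
  have po' : one *m (pinv x)^T = 0 by rewrite -[one]trmxK -trmx_mul po trmx0.
  have [w] := pyramid_gram pyr; move: (barymx a u) => B xx.
  have : pinv x *m (x *m x^T) *m (pinv x)^T = 1%:M.
    by rewrite mulmxA pinvK// mul1mx -trmx_mul pinvK// trmx1.
  rewrite xx !mulmxDr !mulmxDl !(mulmxA (pinv x)) po !mul0mx add0r.
  rewrite -(mulmxA _ one) po' mulmx0 add0r -scalemxAr -scalemxAl mulmxBr mulmxBl.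
  by rewrite !(mulmxA (pinv x)) po !mul0mx subr0 [(_ *m B)^T]trmx_mul !mulmxA.
rewrite /flow mean0 scaler0 add0r lamE pathE hyperE /frame gramE cholesky1.
by rewrite scale_scalar_mx mulr1 -raddfD /= subrK mulmx1.
Qed.

(** ** The flow ends in pyramidal configurations *)

(** Differences of vertices other than [a] are fixed by the projection and by
    [barymx], so the final Gram matrix gives them length 1. *)
Lemma flow_end x : embedding_space R n x -> pyramidal (flow 1 x).
Proof.
move=> xE; have [v [a [s uw]]] := target_weights hn xE.
apply: (@pyramid_pyramidal _ v a s (target x)).
have t1 : 0 <= (1 : R) <= 1 by rewrite ler01 lexx.
split=> //; first last.
- exact: mean_flow1.
- by have := path_flow hn xE t1; rewrite cap_path1.
move=> i j; rewrite !inE => ia ja ij; apply/eucl_dist1.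
have su := target_sum0 hn xE; have u0 := target_neq0 hn xE.
pose z : 'rV[R]_n.+2 := delta_mx 0 i - delta_mx 0 j.
have sz : \sum_k z 0 k = 0.
  by rewrite -dot_one dotC dotBr !dot_delta !mxE subrr.
have za : z 0 a = 0.
  by rewrite !mxE !eqxx eq_sym (negbTE ia) eq_sym (negbTE ja) subrr.
have -> : row i (flow 1 x) - row j (flow 1 x) = z *m flow 1 x.
  by rewrite mulmxBl -!rowE.
have zB : z *m (hyper (target x) *m barymx a (target x)) = z.
  have ua : target x 0 a != 0 by rewrite lt_eqF// (weight_a_lt0 hn uw).
  rewrite mulmxA mul_hyper sz mul0r scale0r subr0 mulmxBl -scalemxAl.
  by rewrite !mul_barymx za mul0r scale0r subr0 divff// scale1r subrr scaler0 subr0.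
have : (dot (z *m flow 1 x) (z *m flow 1 x))%:M = (2^-1 * dot z z)%:M :> 'M[R]_1.
  rewrite -mulmx_gram flow1 (frame_gram hn xE uw) -scalemxAr -scalemxAl mulmx_gram.
  by rewrite zB scale_scalar_mx.
move=> /matrixP/(_ 0 0); rewrite !mxE eqxx !mulr1n => ->.
have -> : dot z z = 2; last by rewrite mulVf// pnatr_eq0.
by rewrite dotBr !dot_delta !mxE !eqxx (eq_sym j) (negbTE ij) /=; ring.
Qed.

End PyramidalConfigurations.

(** * Passing to unlabelled configurations *)

Section Quotient.
Context {R : realType} {n : nat}.
Hypothesis hn : (2 < n)%N.
Local Notation E := (embedding_space R n).

Lemma val_embedding (x : E) : embedding_space R n (val x).
Proof. exact: set_valP. Qed.

Definition relabelling (s : 'S_n.+2) (x : E) : E :=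
  exist _ (row_perm s (val x))
    (mem_set (embedding_space_perm s hn (val_embedding x))).

Lemma class_ofP (x y : E) :
  class_of x = class_of y <-> exists s, y = relabelling s x.
Proof.
split=> [/eqmodP/existsP[s /eqP sE]|[s ->]].
  by exists s; apply/val_inj.
by apply/eqmodP/existsP; exists s.
Qed.

Lemma continuous_to_embedding (T : topologicalType) (f : T -> E) :
  continuous (fun y => val (f y)) -> continuous f.
Proof.
move=> /continuousP cf; apply/continuousP => A [W oW <-].
exact: cf.
Qed.

Lemma continuous_val : continuous (fun x : E => val x).
Proof. exact: initial_continuous. Qed.

Lemma relabelling_continuous s : continuous (relabelling s).
Proof.
apply: continuous_to_embedding => x /=.
apply: (@cvg_mx _ _ (nbhs x) (nbhs_filter x)) => i j; rewrite mxE; under eq_cvg do rewrite mxE.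
exact: (cvg_coord (F := nbhs x) (continuous_val (x := x))).
Qed.

(** The saturation of an open set is a union of relabelled copies of it. *)
Lemma class_of_open (A : set E) : open A -> open (@class_of R n @` A).
Proof.
move=> oA; rewrite /open/= /quotient_open.
have -> : \pi_(config_space R n)%qT @^-1` (@class_of R n @` A) =
    \bigcup_(s in [set: 'S_n.+2]) (relabelling s @^-1` A).
  apply/seteqP; split=> y /=.
    by move=> [x Ax /esym/class_ofP[s xE]]; exists s => //=; rewrite -xE.
  move=> [s _ As]; exists (relabelling s y) => //.
  by apply/esym/class_ofP; exists s.
apply: bigcup_open => s _.
by move/continuousP: (@relabelling_continuous s); apply.
Qed.

Definition clamp (t : R) : R := Num.max 0 (Num.min t 1).

Lemma clamp01 t : 0 <= clamp t <= 1.
Proof. by rewrite le_max lexx ge_max ler01 ge_min lexx orbT. Qed.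

Lemma clamp_id t : 0 <= t <= 1 -> clamp t = t.
Proof. by move=> /andP[t0 t1]; rewrite /clamp (min_l t1) (max_r t0). Qed.

Definition flow_embedded (x : E) (t : R) : E :=
  exist _ (flow (clamp t) (val x))
    (mem_set (flow_embedding hn (val_embedding x) (clamp01 t))).

Lemma flow_embedded_continuous :
  continuous (fun p : E * R => flow_embedded p.1 p.2).
Proof.
apply: continuous_to_embedding => -[x t] /=.
apply: (cvg_flow hn (val_embedding x) _ (clamp01 t)).
  by apply: (cvg_comp _ _ (@cvg_fst _ _ _ _ _)); exact: continuous_val.
apply: cvg_maxr; first exact: cvg_cst.
by apply: cvg_minr; [exact: cvg_snd | exact: cvg_cst].
Qed.

Definition class_flow (p : config_space R n * R) : config_space R n :=
  class_of (flow_embedded (repr p.1) p.2).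

Lemma class_flowE x t : class_flow (class_of x, t) = class_of (flow_embedded x t).
Proof.
have /class_ofP[s xE] : class_of (repr (class_of x)) = class_of x by exact: reprK.
rewrite /class_flow /= [in RHS]xE; apply/class_ofP; exists s.
by apply/val_inj; rewrite /= flow_perm//; exact: val_embedding.
Qed.

(** Since the quotient map is open, so is its product with the time interval,
    and continuity can be checked upstairs. *)
Lemma class_flow_continuous : continuous class_flow.
Proof.
move=> [p t] U; rewrite nbhsE => -[V [oV Vp] VU].
have copen : open [set q : E * R | V (class_of (flow_embedded q.1 q.2))].
  have cf : continuous (fun q : E * R => class_of (flow_embedded q.1 q.2)).
    move=> q; apply: continuous_comp; first exact: flow_embedded_continuous.
    exact: pi_continuous.
  by move/continuousP: cf; apply.
have [[A I] /= [nA nI] AI] : nbhs (repr p : E, t)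
    [set q : E * R | V (class_of (flow_embedded q.1 q.2))].
  exact (open_nbhs_nbhs (p := (repr p : E, t)) (conj copen Vp)).
move: nA; rewrite nbhsE => -[A' [oA' A'p] A'A].
have nA : nbhs p (@class_of R n @` A').
  have A'im : (@class_of R n @` A') p by exists (repr p) => //; exact: reprK.
  exact (open_nbhs_nbhs (conj (class_of_open oA') A'im)).
exists (@class_of R n @` A', I) => //=.
move=> [_ t'] /= [[x A'x <-] It']; apply: VU; rewrite class_flowE.
by apply: (AI (x, t')); split=> //; exact: A'A.
Qed.

End Quotient.

Theorem theorem2p7 (R : realType) (n : nat) (hn : (2 < n)%N) :
  deformation_retracts R (config_space R n) (pyramidal_space R n).
Proof.
have surj (p : config_space R n) : exists x, p = class_of x.
  by exists (repr p); rewrite /class_of reprK.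
exists (class_flow hn); split=> [|p|p|].
- by apply: continuous_subspaceT; exact: class_flow_continuous.
- have [x ->] := surj p; rewrite class_flowE; congr class_of.
  apply/val_inj; rewrite /= clamp_id ?lexx ?ler01//.
  by apply: flow0 => //; exact: val_embedding.
- have [x ->] := surj p; rewrite class_flowE.
  exists (flow_embedded hn x 1) => //=; rewrite clamp_id ?lexx ?ler01//.
  by apply: flow_end => //; exact: val_embedding.
- move=> _ t [x /= px <-] t01; rewrite class_flowE; congr class_of.
  apply/val_inj; rewrite /= clamp_id//.
  have xE := val_embedding x.
  have [v [a [s [u pyr]]]] := pyramidal_pyramid hn xE px.
  exact: flow_pyramid pyr.
Qed.
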